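(* Let $P$ be a finite patch of $N$ pentagons of the $\{5,4\}$ tiling with $n$ boundary edges, and fix a boundary pivot. For $b\in\{\bar 0,\bar 1\}^N$ let $|b\rangle\in(\mathbb{C}^2)^{\otimes n}$ be the normalized boundary state of the hyperbolic pentagon code for logical basis input $b$, and let $\Gamma^b$ be its covariance matrix, $\Gamma^b_{j,k}=\frac{\mathrm{i}}{2}\langle b|[\gamma_j,\gamma_k]|b\rangle$ for $1\le j,k\le 2n$. Let $|\omega\rangle=\sum_{b\in\{\bar 0,\bar 1\}^N}c_b|b\rangle$, with $c_b\in\mathbb{C}$ and $\sum_b|c_b|^2=1$, be an arbitrary boundary state of the code. Then the matrix of fermionic two-point correlation functions $G^{(2)}_{j,k}=\frac{\mathrm{i}}{2}\langle\omega|[\gamma_j,\gamma_k]|\omega\rangle$, $1\le j,k\le 2n$, is a convex combination of the covariance matrices $\Gamma^b$, $b\in\{\bar 0,\bar 1\}^N$.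
   Context: Majorana operators. On $L$ spins, with Pauli operators $X_k,Y_k,Z_k$ on site $k$, put $\gamma_{2k-1}=Z_1\cdots Z_{k-1}X_k$ and $\gamma_{2k}=Z_1\cdots Z_{k-1}Y_k$. In the claim $L=n$. Majorana dimer state. A nonzero vector $|\psi\rangle\in(\mathbb{C}^2)^{\otimes L}$ is a Majorana dimer state vector if there are a partition $\Omega$ of $\{1,\dots,2L\}$ into $L$ pairs $(j,k)$ with $j<k$ and signs $p_{j,k}\in\{\pm1\}$ (the dimer parities) such that $(\gamma_j+\mathrm{i}\,p_{j,k}\gamma_k)|\psi\rangle=0$ for all $(j,k)\in\Omega$. These data determine $|\psi\rangle$ up to a scalar. Code states. $|\bar 0\rangle_5$ and $|\bar 1\rangle_5$ are the logical basis states of the $[[5,1,3]]$ code, whose stabilizers are the cyclic permutations of $X_1Z_2Z_3X_4$. They are the normalized Majorana dimer states on $5$ spins, unique up to phase, with dimers $(j,j+5)$, $j=1,\dots,5$, and parities $p_{j,j+5}=+1$ for all $j$ in the case of $|\bar 0\rangle_5$, and $p_{j,j+5}=(-1)^j$ in the case of $|\bar 1\rangle_5$. They have eigenvalue $+1$ and $-1$, respectively, under $Z_1\cdots Z_5$. Up to phase they are invariant under cyclic permutations of the five spins. Hyperbolic pentagon code with fixed input. The $\{5,4\}$ tiling is the regular tiling of the hyperbolic plane by pentagons, four at each vertex. A patch $P$ is a finite, nonempty, edge-connected set of tiles whose union is a closed disk. For an input $b\in\{\bar 0,\bar 1\}^N$, place on tile $t$ the five-index tensor of computational-basis amplitudes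 of $|\bar 0\rangle_5$ or $|\bar 1\rangle_5$ according to $b_t$. Its indices are attached to the five edges of the tile in clockwise order, starting from an arbitrary vertex (the choice only matters up to phase). For each edge shared by two tiles of $P$, contract the two corresponding indices, i.e. set them equal and sum over $\{0,1\}$. The resulting tensor has one index per boundary edge. Ordering the boundary edges clockwise around the disk, starting from a chosen boundary vertex (the boundary pivot), its entries are, after normalization, the computational-basis amplitudes of the boundary state $|b\rangle$. *)

(* Defs.v *)
From mathcomp Require Import all_boot all_order all_algebra.
From mathcomp Require Import complex.
From mathcomp Require Import boolp classical_sets functions reals trigo.
From mathcomp Require Import topology normedtype.

Set Implicit Arguments.
Unset Strict Implicit.
Unset Printing Implicit Defensive.

Import Order.TTheory GRing.Theory Num.Theory.
Import numFieldNormedType.Exports.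

Local Open Scope classical_set_scope.
Local Open Scope ring_scope.

(* Spin states and Majorana operators.  Sites, Majorana indices and edges are
   numbered from 0, so index 2k (resp. 2k+1) below is the Majorana operator
   with 1-based index 2(k+1)-1 (resp. 2(k+1)), acting on site k. *)

Definition bits (L : nat) := {ffun 'I_L -> bool}.

Definition qstate (R : realType) (L : nat) := {ffun bits L -> R[i]^o}.

Definition inner (R : realType) (L : nat) (phi psi : qstate R L) : R[i] :=
  \sum_x (phi x : R[i])^* * psi x.

Definition normalize (R : realType) (L : nat) (psi : qstate R L) : qstate R L :=
  (sqrtC (inner psi psi))^-1 *: psi.

Definition flip (L : nat) (k : 'I_L) (x : bits L) : bits L :=
  [ffun i => (i == k) (+) x i].

Section Majorana.
Variables (R : realType) (L : nat).
Implicit Types psi : qstate R L.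

Definition pauliX (k : 'I_L) psi : qstate R L := [ffun x => psi (flip k x)].

(* Y |0> = i |1> and Y |1> = - i |0> *)
Definition pauliY (k : 'I_L) psi : qstate R L :=
  [ffun x : bits L => (if x k then 'i else - 'i) * psi (flip k x)].

Definition pauliZ (k : 'I_L) psi : qstate R L :=
  [ffun x : bits L => (-1) ^+ x k * psi x].

Definition zstring (k : 'I_L) : qstate R L -> qstate R L :=
  \big[comp/id]_(i < L | (i < k)%N) pauliZ i.

Lemma site_subproof (j : 'I_L.*2) : (j./2 < L)%N.
Proof. by rewrite ltn_half_double. Qed.

Definition site (j : 'I_L.*2) : 'I_L := Ordinal (site_subproof j).

Definition majorana (j : 'I_L.*2) (psi : qstate R L) : qstate R L :=
  zstring (site j)
    (if odd j then pauliY (site j) psi else pauliX (site j) psi).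

Definition covariance (psi : qstate R L) : 'M[R[i]]_(L.*2) :=
  \matrix_(j, k) ('i / 2 *
    inner psi (majorana j (majorana k psi) - majorana k (majorana j psi))).

Definition perfect_pairing (Omega : {set 'I_L.*2 * 'I_L.*2}) : Prop :=
  (forall d, d \in Omega -> (d.1 < d.2)%N) /\
  (forall j, #|[set d in Omega | (d.1 == j) || (d.2 == j)]| = 1%N).

Definition majorana_dimer_state (Omega : {set 'I_L.*2 * 'I_L.*2})
    (p : 'I_L.*2 -> 'I_L.*2 -> int) (psi : qstate R L) : Prop :=
  [/\ psi != 0, perfect_pairing Omega,
      forall j k, (j, k) \in Omega -> p j k = 1 \/ p j k = -1
    & forall j k, (j, k) \in Omega ->
        majorana j psi + ('i * (p j k)%:~R) *: majorana k psi = 0].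

End Majorana.

(* Logical basis states of the [[5,1,3]] code; false stands for logical 0 and
   true for logical 1. *)

Definition code_dimers : {set 'I_5.*2 * 'I_5.*2} :=
  [set d : 'I_5.*2 * 'I_5.*2 | d.2 == (d.1 + 5)%N :> nat].

Definition code_parity (a : bool) (j k : 'I_5.*2) : int :=
  if a then (-1) ^+ j.+1 else 1.

Definition code_state (R : realType) (a : bool) (psi : qstate R 5) : Prop :=
  majorana_dimer_state code_dimers (code_parity a) psi /\ inner psi psi = 1.

(* The {5,4} tiling, in the hyperboloid model: the right-angled regular
   pentagon and its images under the group generated by the reflections in its
   five sides.  This group acts simply transitively on the tiles, so that a
   tile is encoded by the element g of the group carrying the base pentagon to
   it; its side k is the image under g of side k of the base pentagon. *)

Section Tiling.
Variable R : realType.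

(* coordinates (x_0, x_1, x_2), with x_2 timelike *)
Definition lorentz : 'M[R]_3 :=
  \matrix_(i, j) (if i == j then (if i == 2 then -1 else 1) else 0).

Definition mink (x y : 'cV[R]_3) : R := (x^T *m lorentz *m y) 0 0.

Definition hyperboloid : set 'cV[R]_3 :=
  [set x | mink x x = -1 /\ 0 < x 2 0].

(* Outward unit normal of side k of the base pentagon.  The constants are
   determined by mink (side k) (side k) = 1 and mink (side k) (side (k + 1)) = 0;
   the minus sign makes the sides 0, ..., 4 follow each other clockwise. *)
Definition side (k : 'I_5) : 'cV[R]_3 :=
  let theta := pi *+ 2 / 5 in
  (Num.sqrt (1 - cos theta))^-1 *:
    \col_i (if i == 0 then cos (theta *+ k)
            else if i == 1 then - sin (theta *+ k)
            else Num.sqrt (cos theta)).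

Definition reflection (k : 'I_5) : 'M[R]_3 :=
  1%:M - 2 *: (side k *m (side k)^T *m lorentz).

Definition tiling_group : set 'M[R]_3 :=
  [set g | exists w : seq 'I_5, g = \prod_(k <- w) reflection k].

Definition base_pentagon : set 'cV[R]_3 :=
  [set x | hyperboloid x /\ forall k, mink x (side k) <= 0].

Definition tile_region (g : 'M[R]_3) : set 'cV[R]_3 :=
  [set g *m x | x in base_pentagon].

(* The side reached from side k of tile g by i clockwise steps: an element of
   negative determinant reverses the orientation of the base pentagon. *)
Definition clockwise (g : 'M[R]_3) (k i : 'I_5) : 'I_5 :=
  if 0 < \det g then k + i else k - i.

End Tiling.

Definition homeomorphic_sets (T U : topologicalType) (A : set T) (B : set U) :=
  exists (f : T -> U) (g : U -> T),
    [/\ {within A, continuous f}, {within B, continuous g},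
        forall x, A x -> B (f x) /\ g (f x) = x
      & forall y, B y -> A (g y) /\ f (g y) = y].

Definition closed_disk (R : realType) : set (R * R) :=
  [set z | z.1 ^+ 2 + z.2 ^+ 2 <= 1].

Section Patch.
Variables (R : realType) (N : nat) (P : 'I_N -> 'M[R]_3).

(* Side k of tile g is shared with exactly one other tile of the tiling, namely
   g *m reflection k, whose side k it is as well. *)
Definition shares_side (t t' : 'I_N) (k : 'I_5) : bool :=
  P t' == P t *m reflection R k.

Definition adjacent : rel 'I_N := [rel t t' | [exists k, shares_side t t' k]].

Definition is_patch : Prop :=
  [/\ (0 < N)%N, injective P, forall t, tiling_group (P t),
      forall t t', connect adjacent t t'
    & homeomorphic_sets (@closed_disk R) (\bigcup_t tile_region (P t))].

(* (t, k) is side k of tile t *)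
Definition boundary_edge (d : 'I_N * 'I_5) : bool :=
  [forall t', ~~ shares_side d.1 t' d.2].

(* next_edge d d' : the boundary edge d' follows d when the boundary is walked
   along with the patch on the right.  At the end vertex of d one turns around
   this vertex, through the tiles of the patch, until the next boundary edge. *)
Inductive next_edge : 'I_N * 'I_5 -> 'I_N * 'I_5 -> Prop :=
| next_edge_stop t k :
    boundary_edge (t, clockwise (P t) k 1) ->
    next_edge (t, k) (t, clockwise (P t) k 1)
| next_edge_cross t k t' d :
    shares_side t t' (clockwise (P t) k 1) ->
    next_edge (t', clockwise (P t) k 1) d ->
    next_edge (t, k) d.

(* The boundary edges in clockwise order; the pivot is the starting vertex of
   the first one. *)
Definition clockwise_boundary (n : nat) (e : n.-tuple ('I_N * 'I_5)) : Prop :=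
  [/\ uniq e, forall d, (d \in e) = boundary_edge d
    & forall i : 'I_n, next_edge (tnth e i) (tnth e (ordS i))].

(* Contraction of the tensors (code (b t)) placed on the tiles t, whose indices
   are attached to the sides in clockwise order from side start t on.  An index
   value is assigned to every side of every tile, with equal values on the two
   copies of a shared side. *)
Definition contraction (code : bool -> qstate R 5) (start : 'I_N -> 'I_5)
    (n : nat) (e : n.-tuple ('I_N * 'I_5)) (b : {ffun 'I_N -> bool}) :
    qstate R n :=
  [ffun x : bits n =>
    \sum_(s : {ffun 'I_N * 'I_5 -> bool} |
        [forall t, forall t', forall k,
           shares_side t t' k ==> (s (t, k) == s (t', k))]
        && [forall i, s (tnth e i) == x i])
      \prod_t (code (b t)
        [ffun i => s (t, clockwise (P t) (start t) i)] : R[i])].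

Definition boundary_state (code : bool -> qstate R 5) (start : 'I_N -> 'I_5)
    (n : nat) (e : n.-tuple ('I_N * 'I_5)) (b : {ffun 'I_N -> bool}) :
    qstate R n :=
  normalize (contraction code start e b).

End Patch.

(* Main.v *)
(* The weights are w_b = |c_b|^2, so that the claim amounts to
   <b| gamma_j gamma_k |b'> = 0 for all j, k and all b <> b'.

   Expanding the matching conditions on the shared edges into characters turns
   the overlap into a sum, over Pauli exponents (x, z) on all edges that extend
   those of gamma_j gamma_k on the boundary, of products of one-tile overlaps.
   In the five-qubit code Y Z Y on three consecutive sides has, up to a constant
   sign, the eigenvalue (-1)^b; a nonzero term hence satisfies, modulo 2,
     x(k-1) + x(k) + x(k+1) + z(k-1) + z(k+1) = f    with f = b_t + b'_t
   at every side k of every tile t, and the point is to deduce f = 0.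

   Let a tile have m shared sides and v interior corners.  The Euler
   characteristic of the patch makes the sum of 4 - 2m + v at least 4.  If f = 1
   on a tile, the equations put at least 4 - 2m + v Majorana modes on its
   boundary sides, and there are only two modes in total; so some tile has
   f = 0 and 4 - 2m + v > 0.  Such a tile has at most two shared sides, and its
   modes can be moved inwards along its dimers; it is then removed without
   changing the Euler characteristic or adding modes, and induction applies.

   The Euler characteristic is bounded by counting over F_2: a 1-cocycle of the
   patch extends along the single boundary cycle to the whole tiling, where it
   is a coboundary because r_k^2 and (r_k r_(k+1))^2 generate the relations
   between the reflections r_k (Tits' solution of the word problem). *)

Require Import Defs.
From mathcomp Require Import all_boot all_order all_algebra.
From mathcomp Require Import complex.
From mathcomp Require Import boolp reals trigo.
From mathcomp Require Import ring lra zify.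

Set Implicit Arguments.
Unset Strict Implicit.
Unset Printing Implicit Defensive.

Import Order.TTheory GRing.Theory Num.Theory.

Local Open Scope ring_scope.

(** * Arithmetic modulo 5 and the local shape of a tile *)

Lemma sum_I5 (F : 'I_5 -> nat) (j : 'I_5) :
  (\sum_k F k = F j + F (j + 1)%R + F (j + 2)%R + F (j - 2)%R + F (j - 1)%R)%N.
Proof.
rewrite (reindex_inj (addrI j)) !big_ord_recl big_ord0 /= addn0 !addnA.
by congr (F _ + F _ + F _ + F _ + F _)%N; apply/val_inj;
  case: j => [[|[|[|[|[|]]]]] ?].
Qed.

Lemma forall_I5 (Q : 'I_5 -> Prop) (j : 'I_5) :
  Q j -> Q (j + 1) -> Q (j + 2) -> Q (j - 2) -> Q (j - 1) -> forall k, Q k.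
Proof.
move=> q0 q1 q2 q3 q4 k; rewrite -(subrK j k).
rewrite addrC; case: (k - j) => [[|[|[|[|[|]]]]] // lt_i5].
- by rewrite [Ordinal _](_ : _ = 0) ?addr0 //; apply/val_inj.
- by rewrite [Ordinal _](_ : _ = 1) //; apply/val_inj.
- by rewrite [Ordinal _](_ : _ = 2) //; apply/val_inj.
- by rewrite [Ordinal _](_ : _ = - 2) //; apply/val_inj.
- by rewrite [Ordinal _](_ : _ = - 1) //; apply/val_inj.
Qed.

Lemma I5E (j : 'I_5) :
  (j + 1 - 1 = j) * (j + 1 + 1 = j + 2) * (j + 2 - 1 = j + 1) *
  (j + 2 + 1 = j - 2) * (j - 2 - 1 = j + 2) * (j - 2 + 1 = j - 1) *
  (j - 1 - 1 = j - 2) * (j - 1 + 1 = j).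
Proof.
by do !split; apply/val_inj; case: j => [[|[|[|[|[|]]]]] ?].
Qed.

Lemma I5_neq (j : 'I_5) :
  (j + 1 == j = false) * (j + 2 == j = false) * (j - 2 == j = false) *
  (j - 1 == j = false) * (j + 2 == j + 1 = false) * (j - 2 == j + 1 = false) *
  (j - 1 == j + 1 = false).
Proof. by do !split; case: j => [[|[|[|[|[|]]]]] ?]. Qed.

(* Local shape of a tile: [sh k] tells that side k is shared and [cr k] that
   the corner between sides k and k + 1 is interior. *)
Lemma ear_count (sh cr : 'I_5 -> bool) :
  (forall k, cr k -> sh k && sh (k + 1)) ->
  (4 + \sum_k cr k <= 2 * \sum_k sh k
     + \sum_k [&& ~~ sh (k - 1)%R, ~~ sh k & ~~ sh (k + 1)%R])%N.
Proof.
move=> cr_sh.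
have le_cr k : (cr k <= sh k && sh (k + 1)%R)%N by case: (cr k) (cr_sh k) => // ->.
have le_sum : (\sum_k cr k <= \sum_k (sh k && sh (k + 1)%R))%N by apply: leq_sum.
rewrite -(leq_add2l 4) in le_sum; apply: leq_trans le_sum _.
rewrite !(sum_I5 _ 0) !add0r.
have -> : 1 + 1 = 2 :> 'I_5 by apply/val_inj.
have -> : 2 + 1 = - 2 :> 'I_5 by apply/val_inj.
have -> : - 2 + 1 = - 1 :> 'I_5 by apply/val_inj.
have -> : - 1 + 1 = 0 :> 'I_5 by apply/val_inj.
have -> : 1 - 1 = 0 :> 'I_5 by apply/val_inj.
have -> : 2 - 1 = 1 :> 'I_5 by apply/val_inj.
have -> : - 2 - 1 = 2 :> 'I_5 by apply/val_inj.
have -> : - 1 - 1 = - 2 :> 'I_5 by apply/val_inj.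
by case: (sh 0); case: (sh 1); case: (sh 2); case: (sh (- 2)); case: (sh (- 1)).
Qed.

(** An interior corner lies between two shared sides, so m shared sides allow at most m - 1 interior
    corners if 0 < m < 5, and at most 5 if m = 5. Hence 2m < 4 + v forces m <= 2, and v = 1 if m =
    2. *)
Lemma removable_shape (sh cr : 'I_5 -> bool) :
  (forall k, cr k -> sh k && sh (k + 1)) ->
  (2 * \sum_k sh k < 4 + \sum_k cr k)%N ->
  [\/ forall k, sh k = false,
      exists j, sh j /\ forall k, k != j -> sh k = false
    | exists j, [/\ sh j, sh (j + 1), cr j
                  & forall k, k != j -> k != j + 1 -> sh k = false]].
Proof.
move=> cr_sh.
have i11 : 1 + 1 = 2 :> 'I_5 by apply/val_inj.
have i21 : 2 + 1 = - 2 :> 'I_5 by apply/val_inj.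
have i31 : - 2 + 1 = - 1 :> 'I_5 by apply/val_inj.
have i41 : - 1 + 1 = 0 :> 'I_5 by apply/val_inj.
rewrite !(sum_I5 _ 0) !add0r.
have := cr_sh 0; have := cr_sh 1; have := cr_sh 2; have := cr_sh (- 2).
have := cr_sh (- 1); rewrite i11 i21 i31 i41 add0r.
case s0: (sh 0); case s1: (sh 1); case s2: (sh 2); case s3: (sh (- 2));
case s4: (sh (- 1)); case c0: (cr 0); case c1: (cr 1); case c2: (cr 2);
case c3: (cr (- 2)); case c4: (cr (- 1)) => //= p4 p3 p2 p1 p0;
  try (by have := p0 isT); try (by have := p1 isT); try (by have := p2 isT);
  try (by have := p3 isT); try (by have := p4 isT); move=> // _;
  first
  [ by constructor 1; apply: (forall_I5 (j := 0)); rewrite ?add0r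
  | by constructor 2; exists 0; split=> //; apply: (forall_I5 (j := 0)); rewrite ?add0r
  | by constructor 2; exists 1; split=> //; apply: (forall_I5 (j := 0)); rewrite ?add0r
  | by constructor 2; exists 2; split=> //; apply: (forall_I5 (j := 0)); rewrite ?add0r
  | by constructor 2; exists (- 2); split=> //; apply: (forall_I5 (j := 0)); rewrite ?add0r
  | by constructor 2; exists (- 1); split=> //; apply: (forall_I5 (j := 0)); rewrite ?add0r
  | by constructor 3; exists 0; split; rewrite ?add0r //; apply: (forall_I5 (j := 0)); rewrite ?add0r
  | by constructor 3; exists 1; split; rewrite ?i11 //; apply: (forall_I5 (j := 0)); rewrite ?add0r
  | by constructor 3; exists 2; split; rewrite ?i21 //; apply: (forall_I5 (j := 0)); rewrite ?add0r
  | by constructor 3; exists (- 2); split; rewrite ?i31 //; apply: (forall_I5 (j := 0)); rewrite ?add0r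
  | by constructor 3; exists (- 1); split; rewrite ?i41 //; apply: (forall_I5 (j := 0)); rewrite ?add0r ].
Qed.

(** The terms at [d] and [g d] cancel, where [pos] selects one of the two; fixed points contribute
    nothing. *)
Lemma xor_involution (T : finType) (g : T -> T) (pos F : pred T) :
  involutive g -> (forall d, g d != d -> pos (g d) = ~~ pos d) ->
  (forall d, F (g d) = F d) -> (forall d, g d = d -> F d = false) ->
  \big[addb/false]_d F d = false.
Proof.
move=> gK gpos gF fixF; rewrite (bigID pos) /=.
rewrite [X in _ (+) X](reindex_inj (can_inj gK)) /=.
rewrite big_mkcond [X in _ (+) X]big_mkcond -big_split big1 // => d _ /=.
have [gd|/gpos->] := eqVneq (g d) d; first by rewrite gF fixF // !if_same.
by rewrite negbK gF; case: (pos d); rewrite /= ?addbb.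
Qed.

(** * Removing tiles from a patch *)

Section Peeling.
Variables (U : eqType) (s : 'I_5 -> U -> U).
Hypothesis sK : forall k, involutive (s k).
Hypothesis sC : forall k u, s k (s (k + 1) u) = s (k + 1) (s k u).

(** Neighbouring tiles give the same label to their common side, so the vertex between sides k and k
    + 1 of [u] lies between sides with these labels in all four tiles around it. *)
Definition corner_tiles (u : U) (k : 'I_5) : seq U :=
  [:: u; s k u; s (k + 1) u; s k (s (k + 1) u)].

Definition interior (D : seq U) u k := all (mem D) (corner_tiles u k).

Lemma corner_tiles_l u k : perm_eq (corner_tiles (s k u) k) (corner_tiles u k).
Proof.
rewrite /corner_tiles sK -sC sK; apply/permP=> p /=.
by case: (p u); case: (p (s k u)); case: (p (s (k + 1) u)); case: (p _).
Qed.

Lemma corner_tiles_r u k :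
  perm_eq (corner_tiles (s (k + 1) u) k) (corner_tiles u k).
Proof.
rewrite /corner_tiles sK; apply/permP=> p /=.
by case: (p u); case: (p (s k u)); case: (p (s (k + 1) u)); case: (p _).
Qed.

Lemma mem_corner_tiles u v k :
  u \in corner_tiles v k -> perm_eq (corner_tiles u k) (corner_tiles v k).
Proof.
rewrite !inE => /or4P[] /eqP->.
- exact: perm_refl.
- exact: corner_tiles_l.
- exact: corner_tiles_r.
- exact: perm_trans (corner_tiles_l _ _) (corner_tiles_r _ _).
Qed.

Lemma interior_mem D u v k : u \in corner_tiles v k -> interior D u k = interior D v k.
Proof. by move=> /mem_corner_tiles /perm_all uv; rewrite /interior uv. Qed.

Definition generic u := forall k, uniq (corner_tiles u k).

Definition shared (D : seq U) u k := s k u \in D.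

(* 1 <= #tiles - #edges + #vertices, counting only shared edges and interior
   vertices, multiplied by 4; the sums meet an edge twice, a vertex four times. *)
Definition euler (D : seq U) : Prop :=
  (4 + \sum_(u <- D) 2 * \sum_k shared D u k
   <= \sum_(u <- D) (4 + \sum_k interior D u k))%N.

Lemma interior_shared (D : seq U) u k :
  interior D u k -> shared D u k && shared D u (k + 1).
Proof. by rewrite /interior /shared /= => /and4P[_ -> ->]. Qed.

Lemma generic_neq u k : generic u -> s k u != u.
Proof. by move=> /(_ k) /= /andP[]; rewrite !inE !negb_or eq_sym => /and3P[]. Qed.

Lemma sum_rem (D : seq U) g (F : U -> nat) : uniq D -> g \in D ->
  (\sum_(u <- D) F u = F g + \sum_(u <- rem g D) F u)%N.
Proof.
by move=> uD gD; rewrite (perm_big _ (perm_to_rem gD)) big_cons.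
Qed.

Lemma sum_eq_mem (D : seq U) v : uniq D -> (\sum_(u <- D) (u == v) = (v \in D))%N.
Proof.
move=> uD; rewrite -(count_uniq_mem v uD) -sum1_count [in RHS]big_mkcond /=.
by apply: eq_bigr => u _; case: eqP.
Qed.

(* Removing a tile with m shared sides and v interior corners changes
   4 #tiles - 2 #shared sides + #interior corners by -4 (1 - m + v). *)
Lemma euler_rem D g : uniq D -> (forall u, u \in D -> generic u) -> g \in D ->
  (\sum_k shared D g k = 1 + \sum_k interior D g k)%N ->
  euler D -> euler (rem g D).
Proof.
move=> uD genD gD mv; rewrite /euler.
have gen_g := genD g gD.
have uD' := rem_uniq g uD.
have memD' u : (u \in rem g D) = (u != g) && (u \in D) by rewrite mem_rem_uniq.
rewrite !(sum_rem _ uD gD).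
(* A shared side of [g] is lost at [g] and once more at the neighbour. *)
have sh_rem : (\sum_(u <- rem g D) 2 * \sum_k shared D u k =
    \sum_(u <- rem g D) 2 * \sum_k shared (rem g D) u k + 2 * \sum_k shared D g k)%N.
  transitivity (\sum_(u <- rem g D) (2 * \sum_k shared (rem g D) u k
     + 2 * \sum_k (u == s k g)))%N.
    rewrite big_seq [RHS]big_seq; apply: eq_bigr => u; rewrite memD' => /andP[u_g uDD].
    rewrite -mulnDr -big_split /=; congr (_ * _)%N; apply: eq_bigr => k _.
    rewrite /shared memD' -(inj_eq (can_inj (sK k)) u) sK.
    by case: eqP => [->|_] /=; rewrite ?gD ?addn0.
  rewrite big_split /=; congr addn; rewrite -big_distrr exchange_big /=.
  congr (_ * _)%N; apply: eq_bigr => k _; rewrite sum_eq_mem // /shared memD'.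
  by rewrite generic_neq.
(* An interior corner of [g] is lost at [g] and at the three other tiles around it. *)
have int_rem : (\sum_(u <- rem g D) (4 + \sum_k interior D u k) =
    \sum_(u <- rem g D) (4 + \sum_k interior (rem g D) u k)
    + 3 * \sum_k interior D g k)%N.
  transitivity (\sum_(u <- rem g D) ((4 + \sum_k interior (rem g D) u k)
     + \sum_k (interior D g k && (u \in corner_tiles g k))))%N.
    rewrite big_seq [RHS]big_seq; apply: eq_bigr => u; rewrite memD' => /andP[u_g uDD].
    rewrite -addnA -big_split /=; congr (_ + _)%N; apply: eq_bigr => k _.
    have [ug|ug] := boolP (u \in corner_tiles g k).
      rewrite (interior_mem D ug) (interior_mem (rem g D) ug) andbT.
      suff -> : interior (rem g D) g k = false by [].
      by apply/negbTE; rewrite /interior /= memD' eqxx.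
    rewrite andbF addn0; congr nat_of_bool; apply: eq_in_all => w wu /=.
    rewrite memD'; case: (w =P g) => // wg; case/negP: ug.
    by rewrite -wg (perm_mem (mem_corner_tiles wu)) inE eqxx.
  rewrite big_split /=; congr addn; rewrite exchange_big big_distrr /=.
  apply: eq_bigr => k _; case: (boolP (interior D g k)) => ig; last first.
    by rewrite big1 // muln0.
  suff: (\sum_(u <- D) (u \in corner_tiles g k) = 4)%N.
    by rewrite (sum_rem _ uD gD) inE eqxx /= add1n => -[].
  transitivity (\sum_(u <- D) \sum_(v <- corner_tiles g k) (u == v))%N.
    apply: eq_bigr => u _; rewrite -(sum_eq_mem u (gen_g k)).
    by apply: eq_bigr => v _; rewrite eq_sym.
  rewrite exchange_big /= (eq_big_seq (fun=> 1%N)); first by rewrite sum1_size.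
  by move=> v vg; rewrite sum_eq_mem // (allP ig v vg : (v \in D) = true).
move: mv sh_rem int_rem; lia.
Qed.

Definition connected_tiles (D : seq U) := forall Q : U -> Prop,
  (exists2 u, u \in D & Q u) ->
  (forall u k, u \in D -> s k u \in D -> Q u -> Q (s k u)) ->
  forall u, u \in D -> Q u.

Lemma connected_rem1 D g j : uniq D -> connected_tiles D -> g \in D ->
  s j g \in D -> s j g != g -> (forall k, k != j -> s k g \notin D) ->
  connected_tiles (rem g D).
Proof.
move=> uD conD gD jD jg one Q [u0 u0D Qu0] Qs.
have memD' u : (u \in rem g D) = (u != g) && (u \in D) by rewrite mem_rem_uniq.
move: u0D; rewrite memD' => /andP[u0g u0D].
pose Q' u := if u == g then Q (s j g) else Q u.
have Q'D u : u \in D -> Q' u.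
  apply: conD; first by exists u0; rewrite // /Q' (negbTE u0g).
  move=> {}u k uD' kD; rewrite /Q'.
  case: (u =P g) => [ug|/eqP ug].
    move: kD; rewrite ug; case: (k =P j) => [->|/eqP kj]; last by rewrite (negbTE (one k kj)).
    by rewrite (negbTE jg).
  case: eqP => [kg|/eqP kg].
    have uk : u = s k g by rewrite -kg sK.
    have kj : k = j by apply/eqP; apply: contraTT uD' => /one; rewrite uk.
    by rewrite uk kj.
  by apply: Qs; rewrite memD' ?ug ?kg.
by move=> u; rewrite memD' => /andP[ug /Q'D]; rewrite /Q' (negbTE ug).
Qed.

(** The two neighbours of [g] remain connected through the fourth tile at the interior corner j. *)
Lemma connected_rem2 D g j : uniq D -> connected_tiles D -> generic g ->
  interior D g j -> (forall k, k != j -> k != j + 1 -> s k g \notin D) ->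
  connected_tiles (rem g D).
Proof.
move=> uD conD /(_ j) gen ig two Q [u0 u0D Qu0] Qs.
have memD' u : (u \in rem g D) = (u != g) && (u \in D) by rewrite mem_rem_uniq.
move: ig gen; rewrite /interior /= => /and5P[gD jD j1D dD _].
rewrite !inE !negb_or => /and4P[/and3P[g1 g2 g3] /andP[_ n13] n23 _].
move: u0D; rewrite memD' => /andP[u0g u0D].
have QAC : Q (s j g) <-> Q (s j (s (j + 1) g)).
  split=> [QA|QC]; first by rewrite sC; apply: Qs; rewrite ?memD' -?sC ?jD ?dD ?andbT // eq_sym.
  by rewrite -(sK (j + 1) (s j g)); apply: Qs; rewrite ?memD' -?sC ?sK ?jD ?dD ?andbT // 1?eq_sym // sC sK eq_sym.
have QBC : Q (s (j + 1) g) <-> Q (s j (s (j + 1) g)).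
  split=> [QA|QC]; first by apply: Qs; rewrite ?memD' ?j1D ?dD ?andbT // eq_sym.
  by rewrite -(sK j (s (j + 1) g)); apply: Qs; rewrite ?memD' ?sK ?j1D ?dD ?andbT // eq_sym.
pose Q' u := if u == g then Q (s j g) else Q u.
have Q'D u : u \in D -> Q' u.
  apply: conD; first by exists u0; rewrite // /Q' (negbTE u0g).
  move=> {}u k uD' kD; rewrite /Q'.
  case: (u =P g) => [ug|/eqP ug].
    move: kD; rewrite ug; case: (k =P j) => [->|/eqP kj].
      by rewrite eq_sym (negbTE g1).
    case: (k =P j + 1) => [->|/eqP kj1]; last by rewrite (negbTE (two k kj kj1)).
    by rewrite eq_sym (negbTE g2) QBC QAC.
  case: eqP => [kg|/eqP kg].
    have uk : u = s k g by rewrite -kg sK.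
    move: uD'; rewrite uk; case: (k =P j) => [->|/eqP kj] //.
    case: (k =P j + 1) => [->|/eqP kj1]; last by rewrite (negbTE (two k kj kj1)).
    by rewrite QBC QAC.
  by apply: Qs; rewrite memD' ?ug ?kg.
by move=> u; rewrite memD' => /andP[ug /Q'D]; rewrite /Q' (negbTE ug).
Qed.

(** * Tile equations, corner values and modes *)

Variables (x z : U -> 'I_5 -> bool) (f : U -> bool).
Hypothesis x_s : forall u k, x (s k u) k = x u k.
Hypothesis z_s : forall u k, z (s k u) k = z u k.

Definition tile_eq u := forall k,
  x u (k - 1) (+) x u k (+) x u (k + 1) (+) z u (k - 1) (+) z u (k + 1) = f u.

(** Sum of the five equations: each z occurs twice, each x three times and f five times. *)
Lemma tile_eq_sum u j : tile_eq u ->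
  x u j (+) x u (j + 1) (+) x u (j + 2) (+) x u (j - 2) (+) x u (j - 1) = f u.
Proof.
move=> tu; have := tu j; have := tu (j + 1); have := tu (j + 2).
have := tu (j - 2); have := tu (j - 1); rewrite !I5E.
by case: (f u); case: (x u j); case: (x u (j + 1)); case: (x u (j + 2));
  case: (x u (j - 2)); case: (x u (j - 1)); case: (z u j); case: (z u (j + 1));
  case: (z u (j + 2)); case: (z u (j - 2)); case: (z u (j - 1)).
Qed.

(* [c u k] is the value at the corner between sides k and k + 1 of tile u; on
   interior corners it is irrelevant. *)
Definition corner_fun (D : seq U) (c : U -> 'I_5 -> bool) :=
  (forall u k, u \in D -> s k u \in D ->
     c (s k u) k = c u k /\ c (s k u) (k - 1) = c u (k - 1)) /\
  (forall u k, u \in D -> s k u \notin D -> x u k = c u k (+) c u (k - 1)).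

(* Along the boundary, [c] at the corners and [z] at the sides between them
   are the parities of the Jordan-Wigner strings, so that the Majorana operators
   sit on the half-sides at which these values differ. *)
Definition jumps (c : U -> 'I_5 -> bool) u k : nat :=
  ((c u (k - 1)%R (+) z u k) + (c u k (+) z u k))%N.

Definition modes (D : seq U) c u := (\sum_(k | ~~ shared D u k) jumps c u k)%N.

(** Writing x as a difference of [c] turns the equation at the middle side k into [lo (k - 1)] +
    [up (k + 1)] = 1 modulo 2. So exactly one of these two half-sides carries a mode, and different
    k involve different half-sides. *)
Lemma ears_le_modes D c u : corner_fun D c -> u \in D -> tile_eq u -> f u ->
  (\sum_k [&& ~~ shared D u (k - 1)%R, ~~ shared D u k & ~~ shared D u (k + 1)%R]
   <= modes D c u)%N.
Proof.
move=> [_ c2] uD tu fu.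
pose lo k : nat := (~~ shared D u k) && (c u (k - 1)%R (+) z u k).
pose up k : nat := (~~ shared D u k) && (c u k (+) z u k).
have -> : modes D c u = (\sum_k lo (k - 1)%R + \sum_k up (k + 1)%R)%N.
  have -> : (\sum_k lo (k - 1)%R = \sum_k lo k)%N.
    by rewrite [RHS](reindex_inj (addIr (- 1))).
  have -> : (\sum_k up (k + 1)%R = \sum_k up k)%N.
    by rewrite [RHS](reindex_inj (addIr 1)).
  rewrite -big_split /modes big_mkcond /=; apply: eq_bigr => k _.
  by rewrite /lo /up; case: (shared D u k).
rewrite -big_split /=; apply: leq_sum => k _.
case: and3P => // -[s1 s2 s3]; rewrite /lo /up s1 s3 /=.
have := tu k; rewrite fu (c2 _ _ uD s1) (c2 _ _ uD s2) (c2 _ _ uD s3) addrK.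
by case: (c u (k - 1)); case: (c u (k - 1 - 1)); case: (c u k); case: (c u (k + 1));
  case: (z u (k - 1)); case: (z u (k + 1)).
Qed.

(* A tile g with [f g = 0] is removed by moving its modes along its dimers;
   [ga] prolongs [c] to the corners of g that become boundary corners. *)
Lemma modes_rem D c g (ga : 'I_5 -> bool) : uniq D ->
  (forall u, u \in D -> generic u) -> g \in D ->
  corner_fun D c -> (forall k, x g k = ga k (+) ga (k - 1)) ->
  (forall k, ~~ interior D g k -> ga k = c g k) ->
  (\sum_(k | shared D g k) ((ga (k - 1)%R (+) z g k) + (ga k (+) z g k))
   <= \sum_(k | ~~ shared D g k) ((ga (k - 1)%R (+) z g k) + (ga k (+) z g k)))%N ->
  exists2 c', corner_fun (rem g D) c' &
    (\sum_(u <- rem g D) modes (rem g D) c' u <= \sum_(u <- D) modes D c u)%N.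
Proof.
move=> uD genD gD cc xg gac le_ga; have [c1 c2] := cc.
have memD' u : (u \in rem g D) = (u != g) && (u \in D) by rewrite mem_rem_uniq.
(* Vertices of [g] that are interior in [D] become boundary vertices; there [c] was irrelevant, and
   all four tiles get the value [ga]. *)
pose c' u k := if (u \in corner_tiles g k) && interior D g k then ga k else c u k.
have c'_s u k : u \in D -> s k u \in D ->
    c' (s k u) k = c' u k /\ c' (s k u) (k - 1) = c' u (k - 1).
  move=> uD' kD; have [e1 e2] := c1 u k uD' kD; rewrite /c' e1 e2.
  have in_l v w j : (s j v \in corner_tiles w j) = (v \in corner_tiles w j).
    apply/idP/idP=> /mem_corner_tiles/perm_mem <-; last by rewrite !inE eqxx orbT.
    by rewrite !inE sK eqxx orbT.
  have in_r v w j : (s (j + 1) v \in corner_tiles w j) = (v \in corner_tiles w j).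
    apply/idP/idP=> /mem_corner_tiles/perm_mem <-; last by rewrite !inE eqxx !orbT.
    by rewrite !inE sK eqxx !orbT.
  by rewrite in_l; have := in_r u g (k - 1); rewrite subrK => ->.
have c'g k : c' g k = ga k.
  rewrite /c' inE eqxx /=; case: (boolP (interior D g k)) => // /gac.
  by [].
have c'_out u k : u \in D -> s k u \notin D ->
    c' u k = c u k /\ c' u (k - 1) = c u (k - 1).
  move=> uD' kD; split; rewrite /c'; case: andP => // -[ug ig]; case/negP: kD.
    by have := interior_mem D ug; rewrite ig => /interior_shared/andP[].
  by have := interior_mem D ug; rewrite ig => /interior_shared/andP[]; rewrite /shared subrK.
exists c'.
  split=> u k; rewrite !memD' => /andP[ug uDD].
    by case/andP=> _; apply: c'_s.
  case: (s k u =P g) => [kg _|/eqP kg] /=; last first.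
    by move=> kD; have [-> ->] := c'_out u k uDD kD; apply: c2.
  have uk : u = s k g by rewrite -kg sK.
  have kgD : s k g \in D by rewrite -uk.
  by rewrite uk x_s xg; have [-> ->] := c'_s g k gD kgD; rewrite !c'g.
rewrite (sum_rem _ uD gD) [leqRHS]addnC.
(* The shared sides of [g] become boundary sides of its neighbours, with the modes that [ga] puts on
   them. *)
have -> : (\sum_(u <- rem g D) modes (rem g D) c' u =
    \sum_(u <- rem g D) modes D c u +
    \sum_(k | shared D g k) ((ga (k - 1)%R (+) z g k) + (ga k (+) z g k)))%N.
  transitivity (\sum_(u <- rem g D) (modes D c u +
     \sum_(k | shared D g k) (u == s k g) * ((ga (k - 1)%R (+) z g k) + (ga k (+) z g k))))%N.
    rewrite big_seq [RHS]big_seq; apply: eq_bigr => u; rewrite memD' => /andP[ug uDD].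
    rewrite /modes big_mkcond [in RHS]big_mkcond [X in (_ + X)%N]big_mkcond -big_split /=.
    apply: eq_bigr => k _; rewrite /shared memD'.
    have [kg|kg] /= := eqVneq (s k u) g.
      have uk : u = s k g by rewrite -kg sK.
      rewrite -uk uDD kg gD eqxx mul1n /jumps uk z_s.
      have kgD : s k g \in D by rewrite -uk.
      by have [-> ->] := c'_s g k gD kgD; rewrite !c'g.
    rewrite -(can2_eq (sK k) (sK k)) (negbTE kg) mul0n if_same addn0.
    case: ifP => // kD; rewrite /jumps.
    by have [-> ->] := c'_out u k uDD kD.
  rewrite big_split /=; congr addn; rewrite exchange_big /=; apply: eq_bigr => k gk.
  rewrite -big_distrl /= sum_eq_mem ?rem_uniq // memD' (generic_neq k (genD g gD)).
  by move: gk; rewrite /shared => ->; rewrite mul1n.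
rewrite leq_add2l; apply: leq_trans le_ga _.
rewrite /modes; apply/eq_leq/eq_bigr => k gk; rewrite /jumps.
have [n1 n2] : ~~ interior D g k /\ ~~ interior D g (k - 1).
  by split; apply: contra gk => /interior_shared/andP[]; rewrite // subrK.
by rewrite !gac.
Qed.

Section Transfer.
Variables (g : U) (ga : 'I_5 -> bool).
Hypotheses (eq_g : tile_eq g) (fg : f g = false).
Hypothesis x_ga : forall k, x g k = ga k (+) ga (k - 1).

(* The dimer along side k: it pairs the far halves of sides k - 1 and k + 1. *)
Lemma dimer_eq k : ga (k - 2) (+) z g (k - 1) = ga (k + 1) (+) z g (k + 1).
Proof.
have := eq_g k; rewrite fg !x_ga !I5E.
by case: (ga (k - 2)); case: (ga (k + 1)); case: (z g (k - 1)); case: (z g (k + 1));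
  case: (ga k); case: (ga (k - 1)).
Qed.

Let lo k : nat := ga (k - 1) (+) z g k.
Let up k : nat := ga k (+) z g k.

Let loE k : lo k = up (k + 2).
Proof. by rewrite /lo /up; have := dimer_eq (k + 1); rewrite !I5E => <-; congr (nat_of_bool (ga _ (+) _)); apply/val_inj; case: k => [[|[|[|[|[|]]]]] ?]. Qed.

Let upE k : up k = lo (k - 2).
Proof. by rewrite loE subrK. Qed.

(** The dimers pair the halves of side j with [up (j + 2)] and [lo (j - 2)], which lie on other
    sides; every mode on j therefore has a partner there. *)
Lemma transfer1 (sh : 'I_5 -> bool) j : sh j -> (forall k, k != j -> sh k = false) ->
  (\sum_(k | sh k) (lo k + up k) <= \sum_(k | ~~ sh k) (lo k + up k))%N.
Proof.
move=> sj one; rewrite big_mkcond [leqRHS]big_mkcond !(sum_I5 _ j) sj /=.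
rewrite !one ?I5_neq //= (loE j) (upE j).
move: (lo (j + 1)) (up (j + 1)) (lo (j + 2)) (up (j + 2)) (lo (j - 2)).
move: (up (j - 2)) (lo (j - 1)) (up (j - 1)); lia.
Qed.

(** The partners of the four halves of sides j and j + 1 are both halves of j - 2, one of j + 2 and
    one of j - 1. *)
Lemma transfer2 (sh : 'I_5 -> bool) j : sh j -> sh (j + 1) ->
  (forall k, k != j -> k != j + 1 -> sh k = false) ->
  (\sum_(k | sh k) (lo k + up k) <= \sum_(k | ~~ sh k) (lo k + up k))%N.
Proof.
move=> sj sj1 two; rewrite big_mkcond [leqRHS]big_mkcond !(sum_I5 _ j) sj sj1 /=.
rewrite !two ?I5_neq //= (loE j) (upE j) (loE (j + 1)) (upE (j + 1)).
have -> : j + 1 + 2 = j - 2 by apply/val_inj; case: (j) => [[|[|[|[|[|]]]]] ?].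
have -> : j + 1 - 2 = j - 1 by rewrite addrAC -addrA; congr (_ + _); apply/val_inj.
move: (lo (j + 1)) (up (j + 1)) (lo (j + 2)) (up (j + 2)) (lo (j - 2)).
move: (up (j - 2)) (lo (j - 1)) (up (j - 1)); lia.
Qed.
End Transfer.

(** Induction on the number of tiles. The bound 3 suffices, as the Euler inequality yields at least
    4 modes if no tile can be removed. *)
Theorem tile_parity_eq0 D c : uniq D ->
  (forall u, u \in D -> generic u) -> (forall u, u \in D -> tile_eq u) ->
  connected_tiles D -> (D != [::] -> euler D) -> corner_fun D c ->
  (\sum_(u <- D) modes D c u <= 3)%N -> forall u, u \in D -> f u = false.
Proof.
have [n] := ubnP (size D); elim: n => // n IHn in D c *.
rewrite ltnS => szD uD genD eqD conD eulD cc le3 v vD.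
have D0 : D != [::] by case: (D) vD.
have {}eulD := eulD D0.
have [/hasP[g gD /andP[fg]]|] := boolP (has (fun g => ~~ f g &&
  (2 * \sum_k shared D g k < 4 + \sum_k interior D g k)%N) D); last first.
  (* Tiles with f = 1 have at least 4 - 2m + v modes, and for tiles with f = 0 this number is not
     positive. *)
  move=> /hasPn none; suff : (4 <= \sum_(u <- D) modes D c u)%N by lia.
  rewrite -(leq_add2r (\sum_(u <- D) 2 * \sum_k shared D u k)).
  apply: leq_trans eulD _; rewrite -big_split big_seq [leqRHS]big_seq /=.
  apply: leq_sum => u uDD; have := none u uDD; rewrite negb_and negbK.
  case/orP=> [fu|]; last by rewrite -leqNgt => /leq_trans-> //; exact: leq_addl.
  apply: leq_trans (ear_count (fun k => @interior_shared D u k)) _.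
  by rewrite addnC leq_add2r; exact: ears_le_modes cc uDD (eqD u uDD) fu.
have fg0 : f g = false by apply/negbTE.
move=> /(removable_shape (fun k => @interior_shared D g k)).
have IH : (forall w, w \in rem g D -> f w = false) -> f v = false.
  move=> Dg; case: (v =P g) => [-> //|/eqP vg].
  by apply: Dg; rewrite mem_rem_uniq // inE vg.
have szD' : (size (rem g D) < n)%N.
  by rewrite size_rem //; case: (D) D0 szD => //= ? ?; rewrite ltnS.
have sub u : u \in rem g D -> u \in D by apply: mem_rem.
have gen_g := genD g gD.
case=> [none|[j [sj one]]|[j [sj sj1 ij two]]].
- suff -> : v = g by [].
  apply: (conD (fun u => u = g)) vD; first by exists g.
  by move=> u k uDD kD ug; have := none k; rewrite /shared -ug kD.
- have jg := generic_neq j gen_g.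
  have conD' := connected_rem1 uD conD gD sj jg (fun k kj => negbT (one k kj)).
  have nint k : interior D g k = false.
    apply/negP=> /interior_shared/andP[].
    have [->|/one -> //] := eqVneq k j; move=> _; rewrite one //.
    by rewrite -subr_eq0 addrAC subrr add0r.
  have eulD' : euler (rem g D).
    apply: euler_rem => //; rewrite [in RHS]big1 => [|k _]; last by rewrite nint.
    by rewrite (bigD1 j) //= sj big1 // => k /one ->.
  have xg k : x g k = c g k (+) c g (k - 1).
    have [_ c2] := cc; have [->|kj] := eqVneq k j; last by apply: c2; rewrite // -/(shared D g k) one.
    have := tile_eq_sum j (eqD g gD); rewrite fg0.
    rewrite !(c2 g (_ + _)) // -/(shared D g _) ?one ?I5_neq // !I5E.
    by case: (x g j); case: (c g j); case: (c g (j + 1)); case: (c g (j + 2));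
       case: (c g (j - 2)); case: (c g (j - 1)).
  have := modes_rem uD genD gD cc xg (fun k _ => erefl) (transfer1 (eqD g gD) fg0 xg sj one).
  case=> c' cc' le'; apply: IH; apply: (IHn _ c') => // [|u /sub/genD //|u /sub/eqD //|].
    exact: rem_uniq.
  exact: leq_trans le' le3.
- have two' k : k != j -> k != j + 1 -> s k g \notin D.
    by move=> kj kj1; rewrite -/(shared D g k) two.
  have conD' := connected_rem2 uD conD gen_g ij two'.
  have nint k : k != j -> interior D g k = false.
    move=> kj; apply/negP=> /interior_shared/andP[]; have [->|kj1] := eqVneq k (j + 1).
      by move=> _; rewrite two ?I5E ?I5_neq.
    by rewrite two.
  have eulD' : euler (rem g D).
    apply: euler_rem => //.
    rewrite (bigD1 j) //= (bigD1 (j + 1)) ?I5_neq //= sj sj1.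
    rewrite big1 => [|k /andP[kj kj1]]; last by rewrite two.
    by rewrite (bigD1 j) //= ij big1 // => k /nint ->.
  (* The irrelevant value at the interior corner j is replaced by the one that fits side j; side j +
     1 then fits by the sum of the tile equations. *)
  pose ga k := if k == j then c g (j - 1) (+) x g j else c g k.
  have gac k : ~~ interior D g k -> ga k = c g k.
    by rewrite /ga; case: eqP => // ->; rewrite ij.
  have xg k : x g k = ga k (+) ga (k - 1).
    have [_ c2] := cc; have [->|kj] := eqVneq k j.
      by rewrite /ga eqxx I5_neq; case: (c g _); case: (x g j).
    have [->|kj1] := eqVneq k (j + 1); last first.
      rewrite /ga (negbTE kj) -[k - 1 == j](inj_eq (addIr 1)) subrK (negbTE kj1).
      by apply: c2; rewrite ?two'.
    rewrite !I5E /ga eqxx I5_neq.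
    have := tile_eq_sum j (eqD g gD); rewrite fg0.
    rewrite (c2 g (j + 2)) ?two' ?I5_neq // (c2 g (j - 2)) ?two' ?I5_neq //.
    rewrite (c2 g (j - 1)) ?two' ?I5_neq // !I5E.
    by case: (x g j); case: (x g (j + 1)); case: (c g (j + 1)); case: (c g (j + 2));
       case: (c g (j - 2)); case: (c g (j - 1)).
  have := modes_rem uD genD gD cc xg gac (transfer2 (eqD g gD) fg0 xg sj sj1 two).
  case=> c' cc' le'; apply: IH; apply: (IHn _ c') => // [|u /sub/genD //|u /sub/eqD //|].
    exact: rem_uniq.
  exact: leq_trans le' le3.
Qed.
End Peeling.

(** * Reflections in the sides of the pentagon *)

Lemma I5_subE (j k : 'I_5) : (j <= k)%N -> (k - j)%R = (k - j)%N :> nat.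
Proof. by case: k j => [[|[|[|[|[|k]]]]] k5] [[|[|[|[|[|j]]]]] j5]. Qed.

Lemma I5_subE_lt (j k : 'I_5) : (k < j)%N -> (j - k)%N = (5 - (k - j)%R)%N.
Proof. by case: k j => [[|[|[|[|[|k]]]]] k5] [[|[|[|[|[|j]]]]] j5]. Qed.

(* [initial w k]: some occurrence of k in w can be moved to the front by
   commuting letters that are adjacent mod 5. *)
Fixpoint initial (w : seq 'I_5) (k : 'I_5) : bool :=
  if w is j :: w' then (k == j) || [|| k == j + 1 | k == j - 1] && initial w' k
  else false.

(** Reduced words of the right-angled Coxeter group on five generators in which cyclic neighbours
    commute. *)
Fixpoint reduced (w : seq 'I_5) : bool :=
  if w is j :: w' then ~~ initial w' j && reduced w' else true.

(** * Path sums of a cocycle and the word problem *)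

Section Words.
Variables (A : nzRingType) (r : 'I_5 -> A).
Hypothesis rK : forall k, r k * r k = 1.
Hypothesis rC : forall k, r k * r (k + 1) = r (k + 1) * r k.
Hypothesis reduced_neq1 : forall w, reduced w -> \prod_(k <- w) r k = 1 -> w = [::].

Variable phi : A -> 'I_5 -> bool.
Hypothesis phi_sym : forall u k, phi (u * r k) k = phi u k.
Hypothesis phi_vertex : forall u k,
  phi u k (+) phi (u * r k) (k + 1) = phi u (k + 1) (+) phi (u * r (k + 1)) k.

(** Integral of the cocycle [phi] along the path that starts at [u] and crosses the sides listed in
    [w]. *)
Fixpoint path_sum (u : A) (w : seq 'I_5) : bool :=
  if w is k :: w' then phi u k (+) path_sum (u * r k) w' else false.

Lemma path_sum_cat u w w' :
  path_sum u (w ++ w') = path_sum u w (+) path_sum (u * \prod_(k <- w) r k) w'.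
Proof.
elim: w u => [|k w IH] u /=; first by rewrite big_nil mulr1.
by rewrite IH big_cons addbA mulrA.
Qed.

(** The letter j is commuted to the occurrence that cancels it; the path sum is preserved by
    [phi_vertex] in a commutation and by [phi_sym] in the cancellation. *)
Lemma initial_shorten w j : initial w j -> exists w',
  [/\ (size w' <= size w)%N, \prod_(k <- w') r k = \prod_(k <- j :: w) r k
    & forall u, path_sum u w' = path_sum u (j :: w)].
Proof.
elim: w => //= i w IH /orP[/eqP->|/andP[ij /IH[w' [szw' prw' sumw']]]].
  exists w; split=> //; first by rewrite !big_cons mulrA rK mul1r.
  by move=> u; rewrite phi_sym addbA addbb -mulrA rK mulr1.
have ijC : r j * r i = r i * r j.
  by case/orP: ij => /eqP->; rewrite ?rC // -{2 3}(subrK 1 i) rC.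
exists (i :: w'); split=> //.
  by rewrite !big_cons prw' big_cons !mulrA ijC.
move=> u; rewrite /= sumw' /= !addbA -!mulrA ijC; congr (_ (+) _).
case/orP: ij => /eqP->; first by rewrite phi_vertex.
by have := phi_vertex u (i - 1); rewrite subrK => ->.
Qed.

Lemma shorten w : ~~ reduced w -> exists w',
  [/\ (size w' < size w)%N, \prod_(k <- w') r k = \prod_(k <- w) r k
    & forall u, path_sum u w' = path_sum u w].
Proof.
elim: w => //= j w IH; rewrite negb_and negbK => /orP[/initial_shorten|/IH].
  by case=> w' [szw' prw' sumw']; exists w'.
case=> w' [szw' prw' sumw']; exists (j :: w'); split=> //; first by rewrite !big_cons prw'.
by move=> u /=; rewrite sumw'.
Qed.

(** Shortening ends at a reduced word with product 1, which is empty. *)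
Lemma closed_path_sum u w : \prod_(k <- w) r k = 1 -> path_sum u w = false.
Proof.
have [n] := ubnP (size w); elim: n => // n IH in w * => szw w1.
have [rw|/shorten[w' [szw' prw' sumw']]] := boolP (reduced w).
  by rewrite (reduced_neq1 rw w1).
by rewrite -sumw' IH ?prw' //; apply: leq_trans szw' _.
Qed.

Lemma prod_rev w : (\prod_(k <- w) r k) * (\prod_(k <- rev w) r k) = 1.
Proof.
elim: w => [|k w IH]; first by rewrite big_nil mul1r.
rewrite rev_cons -cats1 big_cat /= big_cons big_seq1 !mulrA.
by rewrite -[_ * _ * \prod_(i <- rev w) _]mulrA IH mulr1 rK.
Qed.

Lemma path_sum_end u w w' :
  \prod_(k <- w) r k = \prod_(k <- w') r k -> path_sum u w = path_sum u w'.
Proof.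
move=> ww'.
(* Both paths are closed up by the same way back. *)
have c1 : path_sum u (w ++ rev w') = false.
  by apply: closed_path_sum; rewrite big_cat /= ww' prod_rev.
have c2 : path_sum u (w' ++ rev w') = false.
  by apply: closed_path_sum; rewrite big_cat /= prod_rev.
by move: c1 c2; rewrite !path_sum_cat ww'; do 2 case: path_sum; case: path_sum.
Qed.
End Words.

(** * Geometry of the right-angled pentagon *)

Section Geometry.
Variable R : realType.

Let theta : R := pi *+ 2 / 5.
Let c : R := cos theta.

Lemma theta_gt0 : 0 < theta.
Proof. by have := pi_gt0 R; rewrite /theta; lra. Qed.

Lemma cos_theta_gt0 : 0 < c.
Proof.
apply: cos_gt0_pihalf; have := theta_gt0; have := pi_gt0 R; rewrite /theta; lra.
Qed.

Lemma cos_theta_mul5B (k : nat) : (k <= 5)%N -> cos (theta *+ (5 - k)) = cos (theta *+ k).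
Proof.
move=> k5; rewrite mulrnBr // [theta *+ 5](_ : _ = pi *+ 2); last first.
  by rewrite /theta; field.
by rewrite addrC cosD2pi cosN.
Qed.

Lemma cos_theta_lt1 : c < 1.
Proof.
rewrite lt_neqAle cos_le1 andbT; apply/eqP => c1.
have s0 : sin theta = 0 by apply: cos1sin0; rewrite -/c c1 normr1.
have : 0 < sin theta.
  by apply: sin_gt0_pi; have := theta_gt0; have := pi_gt0 R; rewrite /theta; lra.
by rewrite s0 ltxx.
Qed.

Lemma cos2theta : cos (theta *+ 2) = 2 * c ^+ 2 - 1.
Proof. by rewrite cos_mulr2n -mulr_natl. Qed.

Lemma sum_I3 (F : 'I_3 -> R) : \sum_i F i = F 0 + F 1 + F 2.
Proof.
rewrite !big_ord_recl big_ord0 addr0 addrA.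
by congr (F _ + F _ + F _); apply/val_inj.
Qed.

Lemma minkE (x y : 'cV[R]_3) : mink x y = x 0 0 * y 0 0 + x 1 0 * y 1 0 - x 2 0 * y 2 0.
Proof. by rewrite /mink /lorentz !mxE !sum_I3 !mxE !sum_I3 !mxE /=; ring. Qed.

Lemma reflectionE (k : 'I_5) (y : 'cV[R]_3) :
  reflection R k *m y = y - (2 * mink (side R k) y) *: side R k.
Proof.
rewrite /reflection mulmxBl mul1mx; congr (_ - _).
rewrite -scalemxAl -!mulmxA -scalerA; congr (_ *: _).
by rewrite [_^T *m _]mx11_scalar mul_mx_scalar /mink mulmxA.
Qed.

Lemma minkBZ (x y n : 'cV[R]_3) (a : R) : mink (x - a *: n) y = mink x y - a * mink n y.
Proof. by rewrite !minkE !mxE; ring. Qed.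

Lemma minkC (x y : 'cV[R]_3) : mink x y = mink y x.
Proof. by rewrite !minkE; ring. Qed.

Lemma mink_side (j k : 'I_5) : mink (side R j) (side R k) =
  (cos (theta *+ j - theta *+ k) - c) / (1 - c).
Proof.
have c1 := cos_theta_lt1; have c0 := cos_theta_gt0.
rewrite minkE !mxE /= -/theta -/c cosB.
have r2 : Num.sqrt (1 - c) ^+ 2 = 1 - c by rewrite sqr_sqrtr // subr_ge0 ltW.
have q2 : Num.sqrt c ^+ 2 = c by rewrite sqr_sqrtr // ltW.
have : Num.sqrt (1 - c) != 0 by rewrite sqrtr_eq0 -ltNge subr_gt0.
rewrite -[X in _ = _ / X]r2 -[X in _ = (_ - X) / _]q2.
by move: (Num.sqrt (1 - c)) (Num.sqrt c) => r q r0; field.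
Qed.

Lemma cos_side (j k : 'I_5) : cos (theta *+ j - theta *+ k) = cos (theta *+ (k - j)%R).
Proof.
have [jk|kj] := leqP j k.
  by rewrite I5_subE // -cosN opprB -mulrnBr.
rewrite -mulrnBr 1?ltnW //.
by rewrite I5_subE_lt // cos_theta_mul5B // ltnW.
Qed.

Lemma mink_sideS (k i : 'I_5) :
  mink (side R k) (side R (k + i)) = (cos (theta *+ i) - c) / (1 - c).
Proof. by rewrite mink_side cos_side addrAC subrr add0r. Qed.

Lemma mink_side0 (k : 'I_5) : mink (side R k) (side R k) = 1.
Proof.
have c1 := cos_theta_lt1; rewrite mink_side subrr cos0 divff //.
by rewrite subr_eq0 gt_eqF.
Qed.

Lemma mink_side1 (k : 'I_5) : mink (side R k) (side R (k + 1)) = 0.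
Proof. by rewrite mink_sideS mulr1n subrr mul0r. Qed.

(** From 2c^2 - c - 1 = -(1 - c)(1 + 2c). The value is below -1: sides two apart lie on
    ultraparallel lines. *)
Lemma mink_side2 (k : 'I_5) : mink (side R k) (side R (k + 2)) = - (1 + 2 * c).
Proof.
have c1 := cos_theta_lt1; rewrite mink_sideS cos2theta.
have : 1 - c != 0 by rewrite subr_eq0 gt_eqF.
by move=> ?; field.
Qed.

Lemma mink_side3 (k : 'I_5) : mink (side R k) (side R (k - 2)) = - (1 + 2 * c).
Proof. by rewrite minkC -{2}(subrK 2 k) mink_side2. Qed.

Lemma mink_side4 (k : 'I_5) : mink (side R k) (side R (k - 1)) = 0.
Proof. by rewrite minkC -{2}(subrK 1 k) mink_side1. Qed.

(** The centre of the base pentagon. *)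
Let p0 : 'cV[R]_3 := \col_i (i == 2)%:R.

Lemma mink_p0 (k : 'I_5) : mink p0 (side R k) < 0.
Proof.
have c1 := cos_theta_lt1; have c0 := cos_theta_gt0.
rewrite minkE !mxE /= -/theta -/c !mul0r mul1r !add0r oppr_lt0.
by rewrite mulr_gt0 ?invr_gt0 ?sqrtr_gt0 ?subr_gt0.
Qed.

Lemma reflection_mulE (j k : 'I_5) : reflection R j *m reflection R k =
  reflection R j + reflection R k - 1%:M
  + (4 * mink (side R j) (side R k)) *: (side R j *m (side R k)^T *m lorentz R).
Proof.
rewrite /reflection mulmxBl !mulmxBr !mul1mx mulmx1.
set A := 2 *: (side R j *m _ *m _); set B := 2 *: _.
have -> : A *m B = (4 * mink (side R j) (side R k)) *:
    (side R j *m (side R k)^T *m lorentz R).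
  rewrite /A /B -scalemxAl -scalemxAr scalerA (_ : 2 * 2 = 4); last by ring.
  rewrite -scalerA; congr (_ *: _); rewrite -!mulmxA.
  rewrite [X in _ *m X](_ : _ = mink (side R j) (side R k) *: ((side R k)^T *m lorentz R)).
    by rewrite -scalemxAr.
  rewrite /mink -mul_scalar_mx -[_%:M]mx11_scalar !mulmxA //.
move: (_ *: _) => C; move: A B => A B.
by apply/matrixP=> i i'; rewrite !mxE; ring.
Qed.

Lemma reflectionK (k : 'I_5) : reflection R k *m reflection R k = 1%:M.
Proof.
rewrite reflection_mulE mink_side0 mulr1 /reflection.
move: (side R k *m _ *m _) => A;
by apply/matrixP=> i j; rewrite !mxE; ring.
Qed.

Lemma reflection_orth (j k : 'I_5) : mink (side R j) (side R k) = 0 ->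
  reflection R j *m reflection R k = reflection R j + reflection R k - 1%:M.
Proof.
move=> jk; rewrite reflection_mulE jk mulr0.
by move: (_ *m _ *m _) (_ - _) => A B; rewrite scale0r addr0.
Qed.

(** The matrix determinant lemma, from two block triangular factorizations of one matrix. *)
Lemma det_1Bmul n (u : 'cV[R]_n) (v : 'rV[R]_n) : \det (1%:M - u *m v) = 1 - (v *m u) 0 0.
Proof.
have e1 : block_mx 1%:M u v 1%:M =
    block_mx 1%:M 0 v 1%:M *m block_mx 1%:M u 0 (1%:M - v *m u) :> 'M_(n + 1).
  rewrite mulmx_block !mul1mx !mulmx1 !mulmx0 !mul0mx !addr0 ?add0r.
  by rewrite addrCA subrr addr0.
have e2 : block_mx 1%:M u v 1%:M =
    block_mx (1%:M - u *m v) u 0 1%:M *m block_mx 1%:M 0 v 1%:M :> 'M_(n + 1).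
  rewrite mulmx_block !mul1mx !mulmx1 !mulmx0 ?mul0mx ?addr0 ?add0r.
  by rewrite subrK.
have := congr1 determinant e1; rewrite e2 !det_mulmx !det_lblock !det_ublock !det1 !mulr1 !mul1r.
by rewrite det_mx11 !mxE.
Qed.

Lemma det_reflection (k : 'I_5) : \det (reflection R k) = - 1.
Proof.
rewrite /reflection -mulmxA scalemxAl det_1Bmul -scalemxAr mxE -[_ 0 0]/(mink _ _) mink_side0.
by ring.
Qed.

#[local] Opaque reflection.

Lemma reflectionC (k : 'I_5) :
  reflection R k *m reflection R (k + 1) = reflection R (k + 1) *m reflection R k.
Proof.
have h1 := mink_side1 k.
have h2 : mink (side R (k + 1)) (side R k) = 0 by rewrite -h1; exact: minkC.
rewrite [LHS](reflection_orth h1) [RHS](reflection_orth h2).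
exact: (congr1 (fun A => A - 1%:M) (addrC (reflection R k) (reflection R (k + 1)))).
Qed.

Let act (w : seq 'I_5) : 'cV[R]_3 := (\prod_(k <- w) reflection R k) *m p0.

(** Hyperbolic sine of the signed distance from the line of side k to the centre of the tile [w],
    positive beyond that side. *)
Let height w k := mink (act w) (side R k).

Lemma height_cons j w k :
  height (j :: w) k = height w k - 2 * height w j * mink (side R j) (side R k).
Proof.
by rewrite /height /act big_cons -mulmxA reflectionE minkBZ [mink (side R j) (_ *m _)]minkC.
Qed.

(* The half-planes beyond two non-adjacent sides are disjoint; the second
   conjunct is the form of this fact that is preserved by reflections. *)
Lemma reduced_height w : reduced w ->
  (forall k, if initial w k then 0 < height w k else height w k < 0) /\
  (forall k, height w k + height w (k + 2) < 0).
Proof.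
have c1 := cos_theta_lt1; have c0 := cos_theta_gt0.
elim: w => [_|j w IH].
  have h k : height [::] k < 0 by rewrite /height /act big_nil mul1mx mink_p0.
  by split=> k; [exact: h | have := h k; have := h (k + 2); lra].
case/andP=> nj /IH[sgn far] {IH}.
(* The tile of [w] has its centre on the inner side of side j, so the reflection takes it beyond
   that side and lowers its heights at j + 2 and j - 2. *)
have aj : height w j < 0 by have := sgn j; rewrite (negbTE nj).
have h0 : height (j :: w) j = - height w j.
  by rewrite height_cons mink_side0; ring.
have h1 : height (j :: w) (j + 1) = height w (j + 1).
  by rewrite height_cons mink_side1; ring.
have h2 : height (j :: w) (j + 2) = height w (j + 2) + (2 + 4 * c) * height w j.
  by rewrite height_cons mink_side2; ring.
have h3 : height (j :: w) (j - 2) = height w (j - 2) + (2 + 4 * c) * height w j.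
  by rewrite height_cons mink_side3; ring.
have h4 : height (j :: w) (j - 1) = height w (j - 1).
  by rewrite height_cons mink_side4; ring.
have f0 := far j; have f1 := far (j - 2); rewrite subrK in f1.
have f2 := far (j - 1); have f3 := far (j + 1); have f4 := far (j + 2).
have e2 : j - 1 + 2 = j + 1 by rewrite -addrA; congr (_ + _); apply/val_inj.
have e3 : j + 1 + 2 = j - 2 by rewrite -addrA; congr (_ + _); apply/val_inj.
have e4 : j + 2 + 2 = j - 1 by rewrite -addrA; congr (_ + _); apply/val_inj.
rewrite e2 in f2; rewrite e3 in f3; rewrite e4 in f4.
have n24 : j + 2 != j - 1 by rewrite (inj_eq (addrI j)).
have n34 : j - 2 != j - 1 by rewrite (inj_eq (addrI j)).
split; apply: (forall_I5 (j := j)).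
- by rewrite /= eqxx h0 oppr_gt0.
- by rewrite h1 /= I5_neq eqxx; exact: sgn.
- by rewrite h2 /= I5_neq [j + 2 == j + 1]I5_neq [j + 2 == j - 1](negbTE n24) /=; nra.
- by rewrite h3 /= I5_neq [j - 2 == j + 1]I5_neq [j - 2 == j - 1](negbTE n34) /=; nra.
- by rewrite h4 /= !I5_neq /= eqxx; exact: sgn.
- by rewrite h0 h2; nra.
- by rewrite e3 h1 h3; nra.
- by rewrite e4 h2 h4; nra.
- by rewrite subrK h3 h0; nra.
- by rewrite e2 h4 h1.
Qed.

(** A nonempty reduced word moves the centre beyond the side of its first letter. *)
Lemma reduced_prod_neq1 w : reduced w -> \prod_(k <- w) reflection R k = 1 -> w = [::].
Proof.
case: w => // j w rw w1; have [/(_ j) + _] := reduced_height rw.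
rewrite /= eqxx /= /height /act w1 mul1mx => /lt_trans/(_ (mink_p0 j)).
by rewrite ltxx.
Qed.

End Geometry.

(** * Vertices, boundary and Euler characteristic of a patch *)

Section OrbitSum.
Variables (T : finType) (f : T -> T) (u : T -> bool).
Hypothesis f_inj : injective f.

(** [p] sums [u] from the root of the orbit up to x, excluded; it closes up because the whole orbit
    sums to zero. *)
Lemma orbit_primitive :
  (forall x, \big[addb/false]_(y <- orbit f x) u y = false) ->
  exists p : T -> bool, forall x, p (f x) = p x (+) u x.
Proof.
move=> sum0; have symf := fconnect_sym f_inj.
pose S r n := \big[addb/false]_(i < n) u (iter i f r).
exists (fun x => S (froot f x) (findex f (froot f x) x)) => x.
set r := froot f x.
have <- : r = froot f (f x) by apply/eqP; rewrite root_connect // fconnect1.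
have rx : fconnect f r x by rewrite symf; exact: connect_root.
have lt_x := findex_max rx.
rewrite -{1 3}(iter_findex rx) -iterS.
have SS : S r (findex f r x).+1 = S r (findex f r x) (+) u (iter (findex f r x) f r).
  by rewrite /S big_ord_recr.
rewrite -SS; case: (ltngtP (findex f r x).+1 (order f r)) => [lt|gt|eq].
- by rewrite findex_iter.
- by move: (leq_trans gt lt_x); rewrite ltnn.
rewrite eq iter_order // findex0 /S big_ord0.
apply: etrans (esym (sum0 r)) _; rewrite /orbit; move: (order f r) => n.
elim: n => [|n IH]; first by rewrite big_ord0 big_nil.
by rewrite trajectSr big_rcons big_ord_recr IH.
Qed.
End OrbitSum.

Section Initial.
Variables (U : eqType) (s : 'I_5 -> U -> U) (G o : pred U).
Hypothesis sK : forall k, involutive (s k).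
Hypothesis sC : forall k u, s k (s (k + 1) u) = s (k + 1) (s k u).
Hypothesis Gs : forall k u, G u -> G (s k u).
Hypothesis o_s : forall k u, G u -> o (s k u) = ~~ o u.
Hypothesis genG : forall u, G u -> generic s u.
(* The tiling is simply connected. *)
Hypothesis potential : forall phi : U -> 'I_5 -> bool,
  (forall u k, phi (s k u) k = phi u k) ->
  (forall u k, phi u k (+) phi (s k u) (k + 1) = phi u (k + 1) (+) phi (s (k + 1) u) k) ->
  exists h : U -> bool, forall u k, G u -> h (s k u) = h u (+) phi u k.

Variables (N : nat) (P : 'I_N -> U).
Hypothesis P_inj : injective P.
Hypothesis GP : forall t, G (P t).

Notation side := ('I_N * 'I_5)%type.
Implicit Types (t : 'I_N) (k : 'I_5) (d : side).

Definition nbr d : option 'I_N := [pick t' | P t' == s d.2 (P d.1)].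

Lemma nbr_Some d t' : (nbr d == Some t') = (P t' == s d.2 (P d.1)).
Proof.
rewrite /nbr; case: pickP => [t'' /eqP e|none]; last by rewrite none.
by rewrite -e (inj_eq P_inj) eq_sym.
Qed.

(** Tiles with [o] false are mirror images of the base pentagon, and their labels decrease
    clockwise. *)
Definition turn t k (i : 'I_5) : 'I_5 := if o (P t) then k + i else k - i.

Definition cw d : side := (d.1, turn d.1 d.2 1).
Definition cross d : side := if nbr d is Some t' then (t', d.2) else d.
(** A side [d] also stands for the corner of its tile at its clockwise end. One step turns around
    this vertex into the next tile, or moves on along the boundary if [cw d] is a boundary side. *)
Definition vnext d : side := cross (cw d).

Definition bdry d := nbr d == None.

Lemma nbr_sym d t' : nbr d = Some t' -> nbr (t', d.2) = Some d.1.
Proof.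
by move=> /eqP; rewrite nbr_Some => /eqP e; apply/eqP; rewrite nbr_Some /= e sK.
Qed.

Lemma crossK : involutive cross.
Proof.
move=> d; rewrite {2}/cross; case e: (nbr d) => [t'|]; last by rewrite /cross e.
by rewrite /cross (nbr_sym e); case: (d).
Qed.

Lemma cw_inj : injective cw.
Proof.
move=> [t k] [t' k'] [<-]; rewrite /turn /=; case: (o _); first by move=> /addIr->.
by move=> /addIr->.
Qed.

Lemma vnext_inj : injective vnext.
Proof. exact: inj_comp (can_inj crossK) cw_inj. Qed.

Lemma oP d t' : nbr d = Some t' -> o (P t') = ~~ o (P d.1).
Proof. by move/eqP; rewrite nbr_Some => /eqP->; apply: o_s. Qed.

Lemma cw_cross d t' : nbr (cw d) = Some t' -> cw (vnext d) = (t', d.2).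
Proof.
move=> e; rewrite /vnext /cross e /cw /turn (oP e) /=.
by case: (o _); rewrite /= ?addrK ?subrK.
Qed.

(* The corner between [d] and [cw d] of tile [d.1], in the numbering of
   [corner_tiles]. *)
Definition corner d : 'I_5 := if o (P d.1) then d.2 else d.2 - 1.

Definition tiles := [seq P t | t <- enum 'I_N].

Lemma uniq_tiles : uniq tiles.
Proof. by rewrite map_inj_uniq // enum_uniq. Qed.

Lemma mem_tiles u : reflect (exists t, u = P t) (u \in tiles).
Proof.
apply: (iffP mapP) => [[t _ ->]|[t ->]]; first by exists t.
by exists t; rewrite ?mem_enum.
Qed.

Lemma P_in_tiles t : P t \in tiles. Proof. by apply/mem_tiles; exists t. Qed.

Lemma shared_tiles t k : shared s tiles (P t) k = ~~ bdry (t, k).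
Proof.
rewrite /shared /bdry; apply/mem_tiles/idP => [[t' e]|].
  by have /eqP-> : nbr (t, k) == Some t' by rewrite nbr_Some e.
by case e: (nbr (t, k)) => [t'|] // _; exists t'; move/eqP: e; rewrite nbr_Some => /eqP.
Qed.

(* All four tiles around the end vertex of [d] belong to the patch. *)
Definition enclosed d := interior s tiles (P d.1) (corner d).

Lemma bdryE d : ~~ bdry d = (s d.2 (P d.1) \in tiles).
Proof. by case: d => t k; rewrite -shared_tiles. Qed.

Lemma vnext_step d : ~~ bdry (cw d) ->
  [/\ P (vnext d).1 = s (cw d).2 (P d.1), (vnext d).2 = (cw d).2
    & cw (vnext d) = ((vnext d).1, d.2)].
Proof.
rewrite /bdry; case e: (nbr (cw d)) => [t'|] // _.
rewrite (cw_cross e) /vnext /cross e /=; split=> //.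
by move/eqP: e; rewrite nbr_Some => /eqP.
Qed.

Lemma corner_commute d u : s d.2 (s (cw d).2 u) = s (cw d).2 (s d.2 u).
Proof.
rewrite /cw /turn /=; case: (o _); first exact: sC.
by have := sC (d.2 - 1) u; rewrite subrK.
Qed.

Lemma enclosed_mem d : enclosed d =
  [&& s (cw d).2 (P d.1) \in tiles, s d.2 (s (cw d).2 (P d.1)) \in tiles
    & s d.2 (P d.1) \in tiles].
Proof.
rewrite /enclosed /interior /corner /cw /turn /= P_in_tiles.
case: (o _); rewrite ?subrK ?andbT //=.
  by rewrite andbCA; congr andb; rewrite andbC.
by have := sC (d.2 - 1) (P d.1); rewrite subrK => ->; congr andb; rewrite andbC.
Qed.

Lemma enclosedE d : enclosed d = [&& ~~ bdry (cw d), ~~ bdry (cw (vnext d))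
  & ~~ bdry (cw (vnext (vnext d)))].
Proof.
rewrite enclosed_mem [in RHS]bdryE; case: (boolP (_ \in tiles)) => //= sD.
have nb1 : ~~ bdry (cw d) by rewrite bdryE.
have [e1 e2 e3] := vnext_step nb1.
rewrite [in RHS]bdryE e3 /= e1; case: (boolP (_ \in tiles)) => //= sD2.
have nb2 : ~~ bdry (cw (vnext d)) by rewrite bdryE e3 /= e1.
have [f1 f2 f3] := vnext_step nb2.
by rewrite bdryE f3 /= f1 e3 e2 e1 /= corner_commute sK.
Qed.

(** The two reflections at the vertex commute, so the fourth crossing returns to [d]. *)
Lemma enclosed_cycle d : enclosed d ->
  ~~ bdry (cw (vnext (vnext (vnext d)))) /\ vnext (vnext (vnext (vnext d))) = d.
Proof.
rewrite enclosedE => /and3P[n1 n2 n3].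
have [e1 e2 e3] := vnext_step n1; have [f1 f2 f3] := vnext_step n2.
have [g1 g2 g3] := vnext_step n3.
have h : s (cw (vnext (vnext (vnext d)))).2 (P (vnext (vnext (vnext d))).1) = P d.1.
  have ke : (cw (vnext d)).2 = d.2 by rewrite e3.
  have kf : (cw (vnext (vnext d))).2 = (vnext d).2 by rewrite f3.
  by rewrite g3 f2 ke g1 kf f1 ke e1 e2 -[(_, _).2]/d.2 corner_commute !sK.
have n4 : ~~ bdry (cw (vnext (vnext (vnext d)))) by rewrite bdryE h P_in_tiles.
split=> //; have [i1 i2 i3] := vnext_step n4.
rewrite [LHS]surjective_pairing [RHS]surjective_pairing; congr pair.
  by apply: P_inj; rewrite i1 h.
by rewrite i2 g3 [LHS]f2 e3.
Qed.

Lemma enclosed_vnext d : enclosed d -> enclosed (vnext d).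
Proof.
move=> id; have [n4 _] := enclosed_cycle id; rewrite enclosedE n4 andbT.
by rewrite enclosedE in id; case/and3P: id => _ -> ->.
Qed.

Lemma uniq_enclosed_cycle d : enclosed d ->
  uniq [:: d; vnext d; vnext (vnext d); vnext (vnext (vnext d))].
Proof.
rewrite enclosedE => /and3P[n1 n2 n3].
have [e1 e2 e3] := vnext_step n1; have [f1 f2 f3] := vnext_step n2.
have [g1 g2 g3] := vnext_step n3.
have ke : (cw (vnext d)).2 = d.2 by rewrite e3.
have kf : (cw (vnext (vnext d))).2 = (vnext d).2 by rewrite f3.
apply: (@map_uniq _ _ (fun d => P d.1)); rewrite [map _ _]/= g1 kf f1 ke e2 e1.
have -> : s (cw d).2 (s d.2 (s (cw d).2 (P d.1))) = s d.2 (P d.1).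
  by rewrite -corner_commute sK.
have := genG (GP d.1) (corner d); rewrite /corner_tiles /corner.
have := corner_commute d (P d.1); rewrite /cw /turn [(d.1, _).2]/=.
by case: (o _) => eC un; apply: etrans un; apply: perm_uniq; apply/permP=> p /=;
  rewrite ?subrK ?eC; case: (p _); case: (p _); case: (p _); case: (p _).
Qed.

Lemma orbit_enclosed d : enclosed d ->
  orbit vnext d = [:: d; vnext d; vnext (vnext d); vnext (vnext (vnext d))].
Proof.
move=> id; have [_ e4] := enclosed_cycle id.
have := uniq_enclosed_cycle id; set c := [:: _; _; _; _] => uc.
have fc : fcycle vnext c by rewrite /= !eqxx e4 eqxx.
have dc : d \in c by rewrite inE eqxx.
rewrite /orbit (order_cycle fc uc dc) /=; congr [:: _, _, _, _ & _].
Qed.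

Lemma next_bdry d : ~~ enclosed d -> exists2 b, bdry b & fconnect vnext d b.
Proof.
have st e : bdry (cw e) -> vnext e = cw e.
  by rewrite /vnext /cross /bdry => /eqP->.
rewrite enclosedE !negb_and !negbK => /or3P[] h;
  [exists (cw d) | exists (cw (vnext d)) | exists (cw (vnext (vnext d)))] => //;
  rewrite -(st _ h); first exact: fconnect1;
  by rewrite -?[vnext (vnext (vnext d))]/(iter 3 vnext d) -?[vnext (vnext d)]/(iter 2 vnext d) fconnect_iter.
Qed.

Inductive follows : side -> side -> Prop :=
| follows_stop d : bdry (cw d) -> follows d (cw d)
| follows_cross d d' : ~~ bdry (cw d) -> follows (vnext d) d' -> follows d d'.

Variables (len : nat) (bd : len.-tuple side).
Hypothesis mem_e : forall d, (d \in bd) = bdry d.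
Hypothesis e_follows : forall i : 'I_len, follows (tnth bd i) (tnth bd (ordS i)).

Lemma follows_connect d d' : follows d d' -> fconnect vnext d d'.
Proof.
elim=> [{}d b|{}d {}d' _ _ IH]; last by apply: connect_trans (fconnect1 _ _) IH.
have <- : vnext d = cw d; last exact: fconnect1.
by rewrite /vnext /cross; move/eqP: b => ->.
Qed.

(** The cyclic list [bd] contains all boundary sides, and [follows] links consecutive ones within an
    orbit of [vnext]. *)
Lemma one_boundary b b' : bdry b -> bdry b' -> fconnect vnext b b'.
Proof.
rewrite -!mem_e => /tnthP[i ->] /tnthP[j ->].
have symv := fconnect_sym vnext_inj.
have i0n : (0 < len)%N by apply: leq_ltn_trans (ltn_ord i).
have from0 m (mn : (m < len)%N) : fconnect vnext (tnth bd (Ordinal i0n)) (tnth bd (Ordinal mn)).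
  elim: m mn => [|m IH] mn.
    by rewrite (bool_irrelevance mn i0n) connect0.
  have mn' := ltnW mn; apply: connect_trans (IH mn') _.
  have -> : Ordinal mn = ordS (Ordinal mn') by apply/val_inj; rewrite /= modn_small.
  exact: follows_connect.
case: i j => [i ilt] [j jlt]; apply: connect_trans (from0 j jlt).
by rewrite symv from0.
Qed.

(* Only the orbits of interior vertices and the orbit of the boundary occur,
   hence the latter sums to zero if the former and the total sum do. *)
Lemma primitive (u : side -> bool) :
  \big[addb/false]_d u d = false ->
  (forall d, enclosed d -> u d (+) u (vnext d) (+) u (vnext (vnext d))
     (+) u (vnext (vnext (vnext d))) = false) ->
  exists p : side -> bool, forall d, p (vnext d) = p d (+) u d.
Proof.
move=> tot inn; apply: (orbit_primitive vnext_inj) => d.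
have symv := fconnect_sym vnext_inj.
have orb e : enclosed e -> \big[addb/false]_(y <- orbit vnext e) u y = false.
  by move=> ie; rewrite (orbit_enclosed ie) !big_cons big_nil addbF !addbA; exact: inn.
have [id|nid] := boolP (enclosed d); first exact: orb.
have orbE e : \big[addb/false]_(y <- orbit vnext e) u y =
    \big[addb/false]_(y | froot vnext y == froot vnext e) u y.
  rewrite big_uniq ?orbit_uniq //=; apply: eq_bigl => y.
  by rewrite -fconnect_orbit root_connect // symv.
rewrite orbE; move: tot.
rewrite (bigID (fun y => froot vnext y == froot vnext d)) /=.
suff -> : \big[addb/false]_(y | froot vnext y != froot vnext d) u y = false by rewrite addbF.
rewrite (partition_big (froot vnext) (fun r => (r != froot vnext d) && (froot vnext r == r))) /=; last first.
  by move=> y -> /=; rewrite (root_root symv).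
apply: big1 => r /andP[rd rr].
transitivity (\big[addb/false]_(y <- orbit vnext r) u y).
  rewrite orbE; apply: eq_bigl => y; rewrite (eqP rr).
  by case: (froot vnext y =P r) => [->|]; rewrite ?rd // andbF.
(* An orbit that is not an interior vertex meets the boundary, and would thus be the orbit of
   [d]. *)
apply: orb; apply: contraNT rd => nr.
have [b bb db] := next_bdry nid; have [b' bb' rb'] := next_bdry nr.
rewrite -(eqP rr) root_connect //; apply: connect_trans rb' _.
by apply: connect_trans (one_boundary bb' bb) _; rewrite symv.
Qed.


Definition ccw d : side := (d.1, turn d.1 d.2 (- 1)).

Lemma ccwK d : cw (ccw d) = d.
Proof.
by case: d => t k; rewrite /cw /ccw /turn /=; case: (o _); rewrite ?opprK ?subrK ?addrK.
Qed.

Lemma vnext_ccw d : vnext (ccw d) = cross d.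
Proof. by rewrite /vnext ccwK. Qed.

(** Prolongs [p] from the sides of the patch to all tiles, by [false] outside the patch. *)
Definition val_at (p : side -> bool) u k : bool :=
  if [pick t | P t == u] is Some t then p (t, k) else false.

Lemma val_atE p t k : val_at p (P t) k = p (t, k).
Proof.
rewrite /val_at; case: pickP => [t' /eqP/P_inj -> //|/(_ t)].
by rewrite eqxx.
Qed.

Lemma val_at_out p u k : u \notin tiles -> val_at p u k = false.
Proof.
by rewrite /val_at; case: pickP => // t /eqP<-; rewrite P_in_tiles.
Qed.

Section CornerFun.
Variables (x z : U -> 'I_5 -> bool) (p : side -> bool).
Hypothesis p_vnext :
  forall d, p (vnext d) = p d (+) (bdry (cw d) && x (P d.1) (cw d).2).

(** [p d] is the value at the clockwise end of [d]; the side that ends at the corner between k and k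
    + 1 is k or k + 1, according to the orientation. *)
Definition corner_of u k := val_at p u (if o u then k else k + 1).

Lemma p_cross d : p (cross d) = p (ccw d) (+) (bdry d && x (P d.1) d.2).
Proof. by rewrite -vnext_ccw p_vnext ccwK. Qed.

Lemma corner_ofE t k : corner_of (P t) k = p (if o (P t) then (t, k) else ccw (t, k)).
Proof.
by rewrite /corner_of val_atE /ccw /turn /=; case: (o _) => //=; rewrite opprK.
Qed.

Lemma corner_ofB t k : corner_of (P t) (k - 1) = p (if o (P t) then ccw (t, k) else (t, k)).
Proof.
by rewrite /corner_of val_atE /ccw /turn /=; case: (o _) => //=; rewrite subrK.
Qed.

Lemma corner_fun_of : corner_fun s x tiles corner_of.
Proof.
have bdryP d : bdry d -> cross d = d by rewrite /bdry /cross => /eqP->.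
split=> u k /mem_tiles[t ->]; last first.
  rewrite -/(shared s tiles _ _) shared_tiles negbK => b.
  have := p_cross (t, k); rewrite (bdryP _ b) b /= (corner_ofE _ k) corner_ofB => e.
  by case: (o _); rewrite e; case: (p _); case: (x _ _).
rewrite -/(shared s tiles _ _) shared_tiles /bdry; case e: (nbr _) => [t'|] // _.
have e' := nbr_sym e; move: (e); move/eqP; rewrite nbr_Some => /eqP /= <-.
rewrite !(corner_ofE _ k) !corner_ofB (oP e) /=.
have := p_cross (t, k); have := p_cross (t', k).
rewrite /bdry /cross e e' /= !addbF => e1 e2.
by case: (o _); rewrite /= e1 e2.
Qed.

Lemma modes_of : (\sum_(u <- tiles) modes s z tiles corner_of u =
  \sum_(d | bdry d) ((p d (+) z (P d.1) d.2) + (p d (+) x (P d.1) d.2 (+) z (P d.1) d.2)))%N.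
Proof.
rewrite big_map big_enum /=.
rewrite /modes (pair_big_dep xpredT (fun t k => ~~ shared s tiles (P t) k)
  (fun t k => jumps z corner_of (P t) k)) /=.
apply: eq_big => [[t k]|[t k]] /=; first by rewrite shared_tiles negbK.
rewrite shared_tiles negbK => b; rewrite /jumps (corner_ofE _ k) corner_ofB.
have := p_cross (t, k); rewrite {1}/cross b (eqP b) /=.
by move=> e; case: (o _); rewrite e; case: (p _); case: (x _ _); case: (z _ _).
Qed.
End CornerFun.

Lemma cross_bdry d : bdry d -> cross d = d.
Proof. by rewrite /bdry /cross => /eqP->. Qed.

Lemma cross_tile d : ~~ bdry d -> P (cross d).1 = s d.2 (P d.1).
Proof.
rewrite /bdry /cross; case e: (nbr d) => [t|] // _.
by move/eqP: e; rewrite nbr_Some => /eqP.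
Qed.

Lemma cross_side d : (cross d).2 = d.2.
Proof. by rewrite /cross; case: (nbr d). Qed.

Lemma bdry_cross d : bdry (cross d) = bdry d.
Proof.
rewrite /bdry /cross; case e: (nbr d) => [t|]; last by rewrite e.
by rewrite (nbr_sym e).
Qed.

Lemma o_cross d : ~~ bdry d -> o (P (cross d).1) = ~~ o (P d.1).
Proof. by move=> /cross_tile->; apply: o_s. Qed.

(** * Extension of cocycles to the whole tiling *)

Section Cohomology.
Variable phi : side -> bool.
Hypothesis phi_bdry : forall d, bdry d -> phi d = false.
Hypothesis phi_cross : forall d, phi (cross d) = phi d.
Hypothesis phi_enclosed : forall d, enclosed d ->
  phi (cw d) (+) phi (cw (vnext d)) (+) phi (cw (vnext (vnext d)))
    (+) phi (cw (vnext (vnext (vnext d)))) = false.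

(* The cocycle extends to the boundary, by [primitive], and then by zero to the
   edges that do not meet the patch. *)
Lemma cocycle_potential : exists h : U -> bool,
  forall d, ~~ bdry d -> h (P (cross d).1) = h (P d.1) (+) phi d.
Proof.
(* The two copies of a shared side cancel in the sum. *)
have tot : \big[addb/false]_d phi (cw d) = false.
  rewrite -(reindex_inj cw_inj (P := xpredT) (F := phi)) /=.
  apply: (xor_involution (pos := fun d => o (P d.1)) crossK) => // d dd.
    by apply: o_cross; apply: contra dd => /cross_bdry ->.
  by apply: phi_bdry; apply/negPn/negP => /o_cross; rewrite dd; case: (o _).
have [p p_vnext] := primitive tot phi_enclosed.
have p_cross d : p (cross d) = p (ccw d) (+) phi d by rewrite -vnext_ccw p_vnext ccwK.
pose back u k := if o u then k - 1 else k + 1.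
(* [psi] adds the values of [p] at the two corners that meet along side k at its start vertex. It
   equals [phi] on shared sides. By [psi_sym] either end vertex may be used, so that around a vertex
   each corner occurs twice and [psi] is a cocycle. *)
pose psi u k := val_at p u (back u k) (+) val_at p (s k u) k.
have backE t k : back (P t) k = (ccw (t, k)).2.
  by rewrite /back /ccw /turn /=; case: (o _); rewrite ?opprK.
have psiE d : ~~ bdry d -> psi (P d.1) d.2 = phi d.
  move=> nb; rewrite /psi -(cross_tile nb) !val_atE backE.
  have -> : ((cross d).1, d.2) = cross d by rewrite [RHS]surjective_pairing cross_side.
  by rewrite p_cross; case: (d) => t k; rewrite -[(t, (ccw _).2)]/(ccw (t, k)) addKb.
have psi_out u k : ~ G u -> psi u k = false.
  move=> nG; rewrite /psi !val_at_out //; apply/negP=> /mem_tiles[t e]; apply: nG.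
    by rewrite -(sK k u) e; apply: Gs.
  by rewrite e.
have psi_sym u k : psi (s k u) k = psi u k.
  wlog /mem_tiles[t ->] : u / u \in tiles => [wl|].
    have [/wl//|nu] := boolP (u \in tiles).
    have [/wl|nv] := boolP (s k u \in tiles); first by rewrite sK => ->.
    by rewrite /psi sK !val_at_out.
  have [b|nb] := boolP (bdry (t, k)); last first.
    have e := cross_tile nb; rewrite /= in e.
    have := psiE (cross (t, k)); rewrite bdry_cross phi_cross cross_side e => -> //.
    by rewrite -(psiE (t, k)).
  have nD : s k (P t) \notin tiles by rewrite -/(shared s tiles _ _) shared_tiles b.
  rewrite /psi sK !(val_at_out p _ nD) backE !val_atE addbF /=.
  by have := p_cross (t, k); rewrite cross_bdry // phi_bdry // addbF.
have o_s' u k : G u -> o (s k u) = ~~ o u by apply: o_s.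
case: (@potential psi psi_sym) => [u k|h hs]; last first.
  exists h => d nb; rewrite (cross_tile nb) hs // psiE //.
have [Gu|/negP nGu] := boolP (G u); last first.
  have nGs j : ~ G (s j u) by move=> Gj; apply: nGu; rewrite -(sK j u); apply: Gs.
  by rewrite !psi_out.
have sC' : s k (s (k + 1) u) = s (k + 1) (s k u) := sC k u.
have [Gk Gk1] : G (s k u) /\ G (s (k + 1) u) by split; apply: Gs.
have Gw : G (s (k + 1) (s k u)) by apply: Gs.
case ou: (o u).
- rewrite -(psi_sym u k) -(psi_sym (s k u) (k + 1)) /psi /back.
  rewrite !o_s' // !ou !sK /= sC' ?sK addrK.
  move: (val_at p u k) (val_at p (s k u) (k + 1)) (val_at p (s (k + 1) u) (k + 1)).
  move: (val_at p _ k); do 4 case; by [].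
- rewrite -(psi_sym u (k + 1)) -(psi_sym (s (k + 1) u) k) /psi /back.
  rewrite sC' !o_s' // !ou /= -sC' !sK addrK.
  move: (val_at p u (k + 1)) (val_at p (s k u) k) (val_at p (s (k + 1) u) k).
  move: (val_at p _ (k + 1)); do 4 case; by [].
Qed.
End Cohomology.

(** * The Euler characteristic of the patch over F_2 *)

Let xorset (T : finType) (A B : {set T}) : {set T} := [set d | (d \in A) (+) (d \in B)].

(* An edge is represented by its side in the positively oriented tile. *)
Let Edges : {set side} := [set d | ~~ bdry d && o (P d.1)].
Let vert d : {set side} := [set e in orbit vnext d].
Let Verts : {set {set side}} := [set vert d | d in enclosed].

Let chain (A : {set side}) d : bool := if o (P d.1) then d \in A else cross d \in A.
Let cobdry (A : {set side}) : {set {set side}} :=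
  [set B in Verts | \big[addb/false]_(d in B) chain A (cw d)].

Lemma chain_xor A B d : chain (xorset A B) d = chain A d (+) chain B d.
Proof. by rewrite /chain; case: (o _); rewrite inE. Qed.

Lemma cobdry_xor A B : cobdry (xorset A B) = xorset (cobdry A) (cobdry B).
Proof.
apply/setP=> v; rewrite !inE; case: (v \in Verts) => //=.
by rewrite -big_split /=; apply: eq_bigr => d _; exact: chain_xor.
Qed.

Lemma big_vert (F : side -> bool) d : enclosed d -> \big[addb/false]_(e in vert d) F e =
  F d (+) F (vnext d) (+) F (vnext (vnext d)) (+) F (vnext (vnext (vnext d))).
Proof.
move=> id; rewrite (eq_bigl (mem (orbit vnext d))) => [|e]; last by rewrite inE.
rewrite -big_uniq ?orbit_uniq // (orbit_enclosed id) !big_cons big_nil /=.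
by rewrite addbF !addbA.
Qed.

(** By [cocycle_potential] a cocycle is the gradient of a function on the tiles, which can be taken
    to vanish at [t0]; N - 1 bits remain. *)
Lemma card_cocycles (t0 : 'I_N) :
  (#|[set A in powerset Edges | cobdry A == set0]| <= 2 ^ N.-1)%N.
Proof.
pose grad (H : {set 'I_N}) : {set side} :=
  [set d in Edges | (d.1 \in H) (+) ((cross d).1 \in H)].
have <- : #|powerset (~: [set t0])| = (2 ^ N.-1)%N.
  by rewrite card_powerset cardsC1 card_ord.
apply: leq_trans (leq_imset_card grad _); apply: subset_leq_card; apply/subsetP=> A.
rewrite inE powersetE => /andP[/subsetP AE /eqP cA].
have chain_bdry d : bdry d -> chain A d = false.
  move=> b; rewrite /chain cross_bdry // if_same; apply/negP=> /AE.
  by rewrite inE b.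
have chain_cross d : chain A (cross d) = chain A d.
  have [b|nb] := boolP (bdry d); first by rewrite cross_bdry.
  by rewrite /chain o_cross // crossK; case: (o _).
have [d id|h hP] := cocycle_potential chain_bdry chain_cross.
  rewrite -(big_vert (fun d => chain A (cw d)) id).
  apply/negP=> odd_d; have : vert d \in cobdry A by rewrite inE odd_d andbT imset_f.
  by rewrite cA inE.
apply/imsetP; exists [set t | h (P t) (+) h (P t0)].
  by rewrite powersetE; apply/subsetP=> t; rewrite !inE; apply: contraTN => /eqP->; rewrite addbb.
apply/setP=> d; rewrite !inE; case: (boolP (~~ bdry d && o (P d.1))) => [/andP[nb od]|nE] /=; last first.
  by apply/negP=> /AE; rewrite inE (negbTE nE).
rewrite hP // /chain od; case: (h (P d.1)); case: (h (P t0)); by case: (d \in A).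
Qed.

(* With E, V the shared edges and interior vertices, the coboundary from F_2^E
   to F_2^V has fibers of size at most 2^(N-1). *)
Lemma card_edges (t0 : 'I_N) : (#|Edges| <= N.-1 + #|Verts|)%N.
Proof.
rewrite -(leq_exp2l _ _ (isT : (1 < 2)%N)) -card_powerset.
set ker := [set A in powerset Edges | cobdry A == set0].
apply: (@leq_trans (#|powerset Verts| * #|ker|)); last first.
  by rewrite card_powerset expnD mulnC leq_mul2r (card_cocycles t0) orbT.
rewrite -sum1_card (partition_big cobdry (mem (powerset Verts))) /=; last first.
  by move=> A _; rewrite powersetE; apply/subsetP=> v; rewrite inE => /andP[].
rewrite -sum_nat_const; apply: leq_sum => v _; rewrite sum1_card.
have [A0 /andP[A0E /eqP A0v]|none] := pickP (fun A => (A \in powerset Edges) && (cobdry A == v)); last first.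
  by rewrite (eq_card0 none).
have xorK : injective (fun A => xorset A A0 : {set side}).
  move=> A B /setP AB; apply/setP=> d; have := AB d; rewrite !inE.
  by case: (d \in A); case: (d \in B); case: (d \in A0).
rewrite -(card_imset _ xorK) subset_leq_card //; apply/subsetP=> _ /imsetP[A hA ->].
have {hA} : (A \in powerset Edges) && (cobdry A == v) by exact: hA.
rewrite powersetE => /andP[/subsetP AE /eqP Av].
move: A0E; rewrite powersetE => /subsetP A0E; rewrite inE powersetE.
apply/andP; split.
  apply/subsetP=> d; rewrite inE; case: (boolP (d \in A)) => [/AE //|_].
  by move=> /A0E.
by rewrite cobdry_xor Av A0v; apply/eqP/setP=> w; rewrite !inE addbb.
Qed.

Lemma card_verts : (4 * #|Verts| = #|[set d | enclosed d]|)%N.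
Proof.
rewrite -[in RHS]sum1_card (partition_big vert (mem Verts)) /=; last first.
  by move=> d; rewrite inE => id; apply: imset_f.
rewrite mulnC -sum_nat_const; apply: eq_bigr => _ /imsetP[d id ->].
have cycd := orbit_enclosed id.
transitivity #|vert d|; first by rewrite cardsE (card_uniqP (orbit_uniq vnext d)) cycd.
rewrite sum1_card; apply: eq_card => e; rewrite !inE.
have symv := fconnect_sym vnext_inj.
apply/idP/andP => [ed|[_ /eqP/setP/(_ e)]]; last first.
  by rewrite !inE -fconnect_orbit connect0 => <-.
split; last first.
  apply/eqP/setP=> y; rewrite !inE -!fconnect_orbit.
  by apply: same_connect => //; rewrite symv fconnect_orbit.
move: ed; rewrite -fconnect_orbit => /iter_findex <-.
by rewrite ?inE; elim: (findex _ _ _) => //= n /enclosed_vnext.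
Qed.

Lemma card_shared : #|[set d | ~~ bdry d]| = (2 * #|Edges|)%N.
Proof.
rewrite mul2n -addnn -(cardsID [set d | o (P d.1)] [set d | ~~ bdry d]).
congr (_ + _)%N; first by apply: eq_card => d; rewrite !inE.
rewrite -(card_imset _ (can_inj crossK)); apply: eq_card => d; rewrite !inE.
apply/imsetP/idP => [[e + ->]|/andP[nb od]].
  by rewrite !inE => /andP[noe nb]; rewrite bdry_cross nb o_cross.
by exists (cross d); rewrite ?crossK // !inE bdry_cross nb o_cross // od.
Qed.

Lemma sum_tiles_interior : (\sum_(u <- tiles) \sum_k interior s tiles u k = #|[set d | enclosed d]|)%N.
Proof.
rewrite big_map big_enum /=.
transitivity (\sum_(t : 'I_N) \sum_k enclosed (t, k))%N.
  apply: eq_bigr => t _; rewrite /enclosed /corner /=; case: (o _) => //.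
  by rewrite [LHS](reindex_inj (addIr (- 1))).
rewrite (pair_bigA _ (fun t k => nat_of_bool (enclosed (t, k)))) /= -sum1_card [RHS]big_mkcond /=.
by apply: eq_bigr => -[t k] _; rewrite inE /=; case: (enclosed _).
Qed.

Lemma sum_tiles_shared : (\sum_(u <- tiles) \sum_k shared s tiles u k = #|[set d | ~~ bdry d]|)%N.
Proof.
rewrite big_map big_enum /=.
rewrite (pair_bigA _ (fun t k => nat_of_bool (shared s tiles (P t) k))) /= -sum1_card.
rewrite [RHS]big_mkcond /=.
by apply: eq_bigr => -[t k] _; rewrite inE shared_tiles /=; case: (bdry _).
Qed.

Lemma euler_patch (t0 : 'I_N) : euler s tiles.
Proof.
rewrite /euler -big_distrr big_split /= sum_tiles_shared sum_tiles_interior.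
rewrite card_shared -card_verts.
have -> : (\sum_(u <- tiles) 4 = 4 * N)%N.
  by rewrite big_const_seq count_predT size_map size_enum_ord iter_addn_0 mulnC.
have := card_edges t0; have := ltn_ord t0; lia.
Qed.

(** * The parity theorem for patches *)

Lemma follows_primitive (p v : side -> bool) :
  (forall d, p (vnext d) = p d (+) (bdry (cw d) && v (cw d))) ->
  forall d d', follows d d' -> p d' = p d (+) v d'.
Proof.
move=> pv d d'; elim=> [{}d b|{}d {}d' nb _ ->]; last by rewrite pv (negbTE nb) addbF.
by have := pv d; rewrite b {1}/vnext cross_bdry.
Qed.

(* [x] and [z] are the exponents of X and Z of a family of Pauli operators on
   the edges of the patch, of which the boundary part is, up to phase,
   a product of two Majorana operators on the sites a and b. *)
Theorem patch_parity_eq0 (x z : side -> bool) (f : 'I_N -> bool) (a b : 'I_len) :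
  uniq bd -> connected_tiles s tiles ->
  (forall d, x (cross d) = x d) -> (forall d, z (cross d) = z d) ->
  (forall t k, x (t, k - 1) (+) x (t, k) (+) x (t, k + 1)
     (+) z (t, k - 1) (+) z (t, k + 1) = f t) ->
  (a <= b)%N -> (forall i, x (tnth bd i) = (i == a) (+) (i == b)) ->
  (forall i, i != a -> i != b -> z (tnth bd i) = (a < i < b)%N) ->
  forall t, f t = false.
Proof.
move=> ue conD x_cross z_cross eqf ab xe ze t0.
(* Both tiles at a side are looked up, so that a tile outside the patch sees the same value as its
   neighbour inside. *)
pose ext (v : side -> bool) u k := val_at v u k || val_at v (s k u) k.
have ext_s v u k : ext v (s k u) k = ext v u k by rewrite /ext sK orbC.
have extE v : (forall d, v (cross d) = v d) -> forall t k, ext v (P t) k = v (t, k).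
  move=> v_cross t k; rewrite /ext val_atE.
  have [b_tk|nb] := boolP (bdry (t, k)).
    by rewrite val_at_out ?orbF // -/(shared s tiles _ _) shared_tiles b_tk.
  rewrite -[s k (P t)](cross_tile nb) val_atE.
  have -> : ((cross (t, k)).1, k) = cross (t, k) by rewrite [RHS]surjective_pairing cross_side.
  by rewrite v_cross orbb.
have xE := extE x x_cross; have zE := extE z z_cross.
pose fU u := val_at (fun d => f d.1) u 0.
have tot : \big[addb/false]_d (bdry (cw d) && x (cw d)) = false.
  rewrite -(reindex_inj cw_inj (P := xpredT) (F := fun d => bdry d && x d)) /=.
  transitivity (\big[addb/false]_(d <- bd) x d).
    rewrite [RHS](big_uniq _ ue) /= [RHS]big_mkcond; apply: eq_bigr => d _.
    by rewrite mem_e; case: (bdry d).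
  rewrite big_tuple (eq_bigr (fun i : 'I_len => (i == a) (+) (i == b))) // big_split /=.
  have one c : \big[addb/false]_(i < len) (i == c) = true.
    by rewrite (bigD1 c) //= eqxx big1 // => i /negbTE.
  by rewrite !one.
have [p0 p0v] : exists p : side -> bool,
    forall d, p (vnext d) = p d (+) (bdry (cw d) && x (cw d)).
  apply: primitive => // d id; have [n4 _] := enclosed_cycle id.
  by move: id; rewrite enclosedE => /and3P[/negbTE-> /negbTE-> /negbTE->]; rewrite (negbTE n4).
have n_gt0 : (0 < len)%N by apply: leq_ltn_trans (ltn_ord a).
have lastP : (len.-1 < len)%N by rewrite prednK.
(* Normalized to vanish at the pivot, which is the end of the last boundary side; along the boundary
   [p] is then the indicator of a <= i < b. *)
pose p d := p0 d (+) p0 (tnth bd (Ordinal lastP)).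
have pv d : p (vnext d) = p d (+) (bdry (cw d) && x (cw d)).
  by rewrite /p p0v addbAC.
have pe (i : 'I_len) : p (tnth bd i) = (a <= i < b)%N.
  have step j := follows_primitive pv (e_follows j).
  case: i => m mn; elim: m mn => [|m IH] mn.
    have E0 : Ordinal mn = ordS (Ordinal lastP) by apply/val_inj; rewrite /= prednK // modnn.
    rewrite [in LHS]E0 step {1}/p addbb xe -E0 -!val_eqE /=.
    by case: (nat_of_ord a) ab => [|a'] /=; case: (nat_of_ord b).
  have mn' := ltnW mn.
  have E : Ordinal mn = ordS (Ordinal mn') by apply/val_inj; rewrite /= modn_small.
  rewrite [in LHS]E step IH xe -E -!val_eqE /=.
  have [a' a'E] : exists a' : nat, a' = a by exists a.
  have [b' b'E] : exists b' : nat, b' = b by exists b.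
  move: ab; rewrite -a'E -b'E; clear; lia.
have pv' d : p (vnext d) = p d (+) (bdry (cw d) && ext x (P d.1) (cw d).2).
  by rewrite pv xE.
have tile_eqD u : u \in tiles -> tile_eq (ext x) (ext z) fU u.
  by move=> /mem_tiles[t ->] k; rewrite !xE !zE eqf /fU val_atE.
have le3 : (\sum_(u <- tiles) modes s (ext z) tiles (corner_of p) u <= 3)%N.
  rewrite (modes_of (ext z) pv').
  have -> : (\sum_(d | bdry d) ((p d (+) ext z (P d.1) d.2)
      + (p d (+) ext x (P d.1) d.2 (+) ext z (P d.1) d.2)) =
    \sum_(i < len) ((p (tnth bd i) (+) z (tnth bd i))
      + (p (tnth bd i) (+) x (tnth bd i) (+) z (tnth bd i))))%N.
    rewrite -(big_tuple _ _ bd xpredT (fun d => (p d (+) z d) + (p d (+) x d (+) z d))%N).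
    rewrite [RHS](big_uniq _ ue); apply: eq_big => [d|[t k] _]; first by rewrite mem_e.
    by rewrite xE zE.
  have far (i : 'I_len) : i != a -> i != b ->
      ((p (tnth bd i) (+) z (tnth bd i)) + (p (tnth bd i) (+) x (tnth bd i) (+) z (tnth bd i)) = 0)%N.
    move=> ia ib; rewrite pe xe ze // (negbTE ia) (negbTE ib) addbF.
    by rewrite (_ : (a <= i < b) = (a < i < b))%N ?addbb //; move: ia; rewrite -val_eqE /=; lia.
  rewrite (bigD1 a) //=; have [ba|ba] := eqVneq b a.
    rewrite big1 => [|i ia]; last by apply: far; rewrite ?ba.
    by rewrite addn0; case: (_ (+) _); case: (_ (+) _).
  rewrite (bigD1 b) //= big1 => [|i /andP[ia ib]]; last exact: far.
  rewrite !pe !xe !eqxx (negbTE ba) eq_sym (negbTE ba) leqnn /= ltnn andbF.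
  by case: (_ < _)%N; case: (z _); case: (z _).
have := @tile_parity_eq0 U s sK sC (ext x) (ext z) fU (ext_s x) (ext_s z) tiles (corner_of p) uniq_tiles.
move=> /(_ _ tile_eqD conD (fun _ => euler_patch t0) (corner_fun_of pv') le3 (P t0)).
rewrite /fU val_atE; apply; last exact: P_in_tiles.
by move=> u /mem_tiles[t ->]; apply: genG.
Qed.

End Initial.

(** * Overlaps of contracted code states *)

Definition dot (I : finType) (z x : I -> bool) : bool := \big[addb/false]_i (z i && x i).

Lemma dotDl (I : finType) (z z' x : I -> bool) :
  dot (fun i => z i (+) z' i) x = dot z x (+) dot z' x.
Proof.
by rewrite /dot -big_split; apply: eq_bigr => i _ /=; rewrite andb_addl.
Qed.

Lemma dotDr (I : finType) (z x y : I -> bool) :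
  dot z (fun i => x i (+) y i) = dot z x (+) dot z y.
Proof.
by rewrite /dot -big_split; apply: eq_bigr => i _ /=; rewrite andb_addr.
Qed.

Lemma dot_delta (I : finType) (z : I -> bool) k : dot z (fun i => i == k) = z k.
Proof.
rewrite /dot (bigD1 k) //= eqxx andbT big1 ?addbF // => i /negbTE->.
by rewrite andbF.
Qed.

Lemma eq_dot (I : finType) (z z' x x' : I -> bool) : z =1 z' -> x =1 x' -> dot z x = dot z' x'.
Proof. by move=> zz' xx'; apply: eq_bigr => i _; rewrite zz' xx'. Qed.

Section Overlap.
Variable R : realType.
Local Notation C := R[i].

Lemma signM (a b : bool) : (-1) ^+ a * (-1) ^+ b = (-1) ^+ (a (+) b) :> C.
Proof. by rewrite signr_addb. Qed.

(** * Pauli form of Majorana operators and dimers *)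

Section Pauli.
Variable L : nat.
Implicit Types (psi : qstate R L) (x : bits L).

(** The Majorana operator j is the phase [majorana_c j] times Z with exponents [majorana_z j] times
    X on its site, by Y = -i Z X. *)
Definition majorana_z (j : 'I_L.*2) (i : 'I_L) : bool :=
  (i < site j)%N || (i == site j) && odd j.

Definition majorana_c (j : 'I_L.*2) : C := if odd j then - 'i else 1.

Lemma zstringE (k : 'I_L) psi x :
  zstring k psi x = (-1) ^+ (dot (fun i : 'I_L => (i < k)%N) x) * psi x :> C.
Proof.
rewrite /zstring /dot -big_mkcond /=.
pose K (F : qstate R L -> qstate R L) (b : bool) :=
  forall phi, F phi x = (-1) ^+ b * (phi x : C) :> C.
suff : K (\big[comp/id]_(i < L | (i < k)%N) @pauliZ R L i) (\big[addb/false]_(i < L | (i < k)%N) x i).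
  by move=> /(_ psi).
elim/big_rec2: _ => [phi|i F b _ IH phi]; first by rewrite expr0 mul1r.
by rewrite /= ffunE IH mulrA signM.
Qed.

Lemma majoranaE j psi x : majorana j psi x =
  majorana_c j * (-1) ^+ dot (majorana_z j) x * psi (flip (site j) x) :> C.
Proof.
have -> : dot (majorana_z j) x =
    dot (fun i : 'I_L => (i < site j)%N) x (+) (odd j && x (site j)).
  rewrite -(dot_delta (fun=> odd j && x (site j)) (site j)).
  rewrite /dot -big_split; apply: eq_bigr => i _ /=; rewrite /majorana_z.
  have [->|] := eqVneq i (site j); first by rewrite ltnn /= andbT.
  by rewrite andbF addbF orbF.
rewrite /majorana zstringE /majorana_c; case: ifP => oj; rewrite !ffunE /=.
  by rewrite signr_addb; case: (x (site j)); rewrite /= ?expr0 ?expr1; ring.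
by rewrite addbF mul1r.
Qed.

Lemma flipK k : involutive (@flip L k).
Proof. by move=> x; apply/ffunP=> i; rewrite !ffunE addbA addbb. Qed.

Lemma dot_flip (z : 'I_L -> bool) k x : dot z (flip k x) = z k (+) dot z x.
Proof.
rewrite -(dot_delta z k) -dotDr; apply: eq_dot => // i.
by rewrite ffunE.
Qed.

Lemma majorana2E j k : exists c : C, forall psi x, majorana j (majorana k psi) x =
  c * (-1) ^+ dot (fun i => majorana_z j i (+) majorana_z k i) x
    * psi (flip (site k) (flip (site j) x)) :> C.
Proof.
exists (majorana_c j * majorana_c k * (-1) ^+ majorana_z k (site j)) => psi x.
by rewrite !majoranaE dot_flip dotDl !signr_addb; ring.
Qed.

Lemma majorana_cM j : (majorana_c j)^* * majorana_c j = 1.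
Proof.
rewrite /majorana_c; case: ifP => _; last by rewrite rmorph1 mul1r.
by rewrite rmorphN /= conjCi opprK mulrN -expr2 sqrCi opprK.
Qed.

Lemma conj_sign (b : bool) : ((-1) ^+ b : C)^* = (-1) ^+ b.
Proof. by rewrite rmorphXn /= rmorphN rmorph1. Qed.

(** The phase [c] depends on neither [psi] nor [p], so that it cancels in an overlap of two states
    with the same dimers. *)
Lemma dimer_flip j k : exists2 c : C, c^* * c = 1 & forall psi (p : int),
  p = 1 \/ p = -1 -> majorana j psi + ('i * p%:~R) *: majorana k psi = 0 ->
  forall x, psi (flip (site k) (flip (site j) x)) =
    c * p%:~R * (-1) ^+ dot (fun i => majorana_z j i (+) majorana_z k i) x * psi x :> C.
Proof.
exists ('i * majorana_c j * (majorana_c k)^* * (-1) ^+ (majorana_z j (site j) (+) majorana_z k (site j))).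
  rewrite !rmorphM /= conj_sign conjCK conjCi.
  have := majorana_cM j; have := majorana_cM k; set a := majorana_c j; set b := majorana_c k.
  move=> bb aa; transitivity (- ('i ^+ 2) * (a^* * a) * (b^* * b)
    * ((-1) ^+ (majorana_z j (site j) (+) majorana_z k (site j))) ^+ 2 : C); first by ring.
  by rewrite sqrCi aa bb sqrr_sign opprK !mulr1.
move=> psi p p1 /ffunP eq0 x; have := eq0 (flip (site j) x).
rewrite ffunE [X in _ + X]ffunE [X in _ = X]ffunE -[_ *: _]/(_ * _ : C).
rewrite majoranaE [X in _ + _ * X]majoranaE flipK !dot_flip.
set u := psi x; set v := psi _; set a := majorana_c j; set b := majorana_c k.
rewrite dotDl !signr_addb.
set e1 := (-1) ^+ majorana_z j _; set e2 := (-1) ^+ dot _ _.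
set e3 := (-1) ^+ majorana_z k _; set e4 := (-1) ^+ dot _ _ => eq0x.
have bb : b^* * b = 1 := majorana_cM k.
have e33 : e3 * e3 = 1 by rewrite -expr2 sqrr_sign.
have e44 : e4 * e4 = 1 by rewrite -expr2 sqrr_sign.
have pp : p%:~R * p%:~R = 1 :> C by case: p1 => ->; rewrite ?mulr1 // mulrNN mulr1.
have ii : 'i * 'i = -1 :> C by rewrite -expr2 sqrCi.
have {}eq0x : a * (e1 * e2) * u = - ('i * p%:~R * (b * (e3 * e4) * v)).
  by apply/eqP; rewrite -addr_eq0; apply/eqP.
transitivity ('i * p%:~R * b^* * e3 * e4 * (a * (e1 * e2) * u)); last by ring.
rewrite eq0x; transitivity (- ('i * 'i) * (p%:~R * p%:~R) * (b^* * b) * (e3 * e3) * (e4 * e4) * v).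
  by rewrite ii pp bb e33 e44 opprK !mul1r.
by ring.
Qed.
End Pauli.

(** The unit phases cancel, and the dimer parities of the two states differ exactly if a and b
    differ and j, numbered from 0, is even. *)
Lemma code_pair (j k : 'I_5.*2) (code : bool -> qstate R 5) (a b : bool) (x y : bits 5) :
  (forall a, code_state a (code a)) -> k = (j + 5)%N :> nat ->
  (code a (flip (site k) (flip (site j) x)) : C)^* *
     code b (flip (site k) (flip (site j) y)) =
  (-1) ^+ (dot (fun i => majorana_z j i (+) majorana_z k i) (fun i => x i (+) y i)
           (+) ((a (+) b) && ~~ odd j)) * ((code a x : C)^* * code b y) :> C.
Proof.
move=> codeP jk; have [c cc cflip] := dimer_flip j k.
have dim d : (code d (flip (site k) (flip (site j) x)) = c * (code_parity d j k)%:~R *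
    (-1) ^+ dot (fun i => majorana_z j i (+) majorana_z k i) x * code d x :> C)
  /\ (code d (flip (site k) (flip (site j) y)) = c * (code_parity d j k)%:~R *
    (-1) ^+ dot (fun i => majorana_z j i (+) majorana_z k i) y * code d y :> C).
  have [[_ _ par dimd] _] := codeP d.
  have jkd : (j, k) \in code_dimers by rewrite inE /= jk.
  by split; apply: cflip (par _ _ jkd) (dimd _ _ jkd) _.
rewrite (dim a).1 (dim b).2 dotDr !signr_addb.
rewrite !rmorphM /= conj_sign.
have -> : (-1) ^+ ((a (+) b) && ~~ odd j) =
   ((code_parity a j k)%:~R : C)^* * (code_parity b j k)%:~R.
  have parE d : (code_parity d j k)%:~R = if d then (-1) ^+ ~~ odd j else 1 :> C.
    by rewrite /code_parity; case: d; rewrite ?rmorph_sign // -signr_odd.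
  rewrite !parE; case: a b => [] []; rewrite ?conj_sign ?rmorph1 ?mulr1 ?mul1r //=.
  by rewrite -expr2 sqrr_sign.
set p := (code_parity a j k)%:~R; set q := (code_parity b j k)%:~R.
set u := (-1) ^+ dot _ x; set v := (-1) ^+ dot _ y; set s := (code a x)^*; set t := code b y.
transitivity (c^* * c * (u * v * (p^* * q)) * (s * t)); first by ring.
by rewrite cc mul1r.
Qed.

(** * Overlaps of tensor networks *)

Section Network.
Variables (N : nat) (kappa : 'I_N -> 'I_5 -> 'I_5) (code : bool -> qstate R 5).
Hypothesis kappa_inj : forall t, injective (kappa t).
Hypothesis codeP : forall a, code_state a (code a).
Notation side := ('I_N * 'I_5)%type.
Notation config := {ffun side -> bool}.
Implicit Types (s y z : config) (b : {ffun 'I_N -> bool}).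

Definition tile_bits s t : bits 5 := [ffun i => s (t, kappa t i)].

Definition amplitude b s : C := \prod_t code (b t) (tile_bits s t).

Definition addc s y : config := [ffun d => s d (+) y d].

(** The term of s in the overlap of the uncontracted tensors for b and b', with X exponents y and Z
    exponents z inserted on all sides. *)
Definition weight b b' z y s : C :=
  (-1) ^+ dot z s * ((amplitude b s)^* * amplitude b' (addc s y)).

(* The symmetries of the two code states along a dimer rescale every term by
   the same sign, up to a permutation of the terms. *)
Definition flip2 (t : 'I_N) (i j : 'I_5) s : config :=
  [ffun d => (d == (t, kappa t i)) (+) ((d == (t, kappa t j)) (+) s d)].

Lemma flip2K t i j : involutive (flip2 t i j).
Proof.
move=> s; apply/ffunP=> d; rewrite !ffunE.
by case: (d == _); case: (d == _); case: (s d).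
Qed.

Lemma tile_bits_flip2 t i j s t' : tile_bits (flip2 t i j s) t' =
  if t' == t then flip j (flip i (tile_bits s t)) else tile_bits s t'.
Proof.
apply/ffunP=> k; rewrite !ffunE; have [->|t't] := eqVneq t' t.
  by rewrite !ffunE !xpair_eqE eqxx !(inj_eq (@kappa_inj t)) /= addbCA.
by rewrite !ffunE !xpair_eqE (negbTE t't).
Qed.

Lemma weight_flip2 b b' z y s t (j k : 'I_5.*2) : k = (j + 5)%N :> nat ->
  weight b b' z y (flip2 t (site j) (site k) s) =
  (-1) ^+ (z (t, kappa t (site j)) (+) z (t, kappa t (site k)) (+)
     dot (fun i => majorana_z j i (+) majorana_z k i) (tile_bits y t) (+)
     ((b t (+) b' t) && ~~ odd j)) * weight b b' z y s.
Proof.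
move=> jk; rewrite /weight /amplitude !rmorph_prod -!big_split /=.
rewrite (bigD1 t) //= [in RHS](bigD1 t) //=.
have addc_flip2 : addc (flip2 t (site j) (site k) s) y = flip2 t (site j) (site k) (addc s y).
  by apply/ffunP=> d; rewrite !ffunE !addbA.
rewrite addc_flip2 !tile_bits_flip2 eqxx (code_pair _ _ _ _ codeP jk).
rewrite [X in _ * (_ * X) = _](eq_bigr (fun t' => (code (b t') (tile_bits s t') : C)^*
    * code (b' t') (tile_bits (addc s y) t'))); last first.
  by move=> t' /negbTE t't; rewrite !tile_bits_flip2 t't.
have -> : dot z (flip2 t (site j) (site k) s) =
    z (t, kappa t (site j)) (+) z (t, kappa t (site k)) (+) dot z s.
  rewrite -!(dot_delta z) -!dotDr; apply: eq_dot => // d.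
  by rewrite !ffunE addbA.
have -> : dot (fun i => majorana_z j i (+) majorana_z k i)
     (fun i => tile_bits s t i (+) tile_bits (addc s y) t i) =
   dot (fun i => majorana_z j i (+) majorana_z k i) (tile_bits y t).
  by apply: eq_dot => // i; rewrite !ffunE addbA addbb.
by rewrite !signr_addb; ring.
Qed.

Lemma weight_sum_neq0 b b' z y t (j k : 'I_5.*2) : k = (j + 5)%N :> nat ->
  \sum_s weight b b' z y s != 0 ->
  z (t, kappa t (site j)) (+) z (t, kappa t (site k)) (+)
     dot (fun i => majorana_z j i (+) majorana_z k i) (tile_bits y t) (+)
     ((b t (+) b' t) && ~~ odd j) = false.
Proof.
move=> jk; set c := _ (+) _; apply: contraNF => c1.
have : \sum_s weight b b' z y s = \sum_s (-1) ^+ c * weight b b' z y s.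
  rewrite [LHS](reindex_inj (can_inj (flip2K t (site j) (site k)))).
  by apply: eq_bigr => s _; apply: weight_flip2.
rewrite -big_distrr /= c1 expr1 mulN1r => /eqP.
by rewrite -addr_eq0 -mulr2n mulrn_eq0.
Qed.


Lemma xor_I5 (F : 'I_5 -> bool) : \big[addb/false]_i F i =
  F 0 (+) (F 1 (+) (F 2 (+) (F (- 2) (+) F (- 1)))).
Proof.
rewrite !big_ord_recl big_ord0 /= addbF.
by congr (F _ (+) (F _ (+) (F _ (+) (F _ (+) F _)))); apply/val_inj.
Qed.

(** Dimers with j even give YZY at three positions, those with j odd the stabilizers XZZX at two
    positions; together they generate YZY at the remaining positions. *)
Lemma tile_equations b b' z y t i : \sum_s weight b b' z y s != 0 ->
  y (t, kappa t (i - 1)) (+) y (t, kappa t i) (+) y (t, kappa t (i + 1))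
   (+) z (t, kappa t (i - 1)) (+) z (t, kappa t (i + 1)) = b t (+) b' t.
Proof.
move=> T0.
have c0 := @weight_sum_neq0 b b' z y t (@Ordinal 10 0 isT) (@Ordinal 10 5 isT) erefl T0.
have c1 := @weight_sum_neq0 b b' z y t (@Ordinal 10 1 isT) (@Ordinal 10 6 isT) erefl T0.
have c2 := @weight_sum_neq0 b b' z y t (@Ordinal 10 2 isT) (@Ordinal 10 7 isT) erefl T0.
have c3 := @weight_sum_neq0 b b' z y t (@Ordinal 10 3 isT) (@Ordinal 10 8 isT) erefl T0.
have c4 := @weight_sum_neq0 b b' z y t (@Ordinal 10 4 isT) (@Ordinal 10 9 isT) erefl T0.
have s0 p : @site 5 (@Ordinal 10 0 p) = 0 by apply/val_inj.
have s1 p : @site 5 (@Ordinal 10 1 p) = 0 by apply/val_inj.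
have s2 p : @site 5 (@Ordinal 10 2 p) = 1 by apply/val_inj.
have s3 p : @site 5 (@Ordinal 10 3 p) = 1 by apply/val_inj.
have s4 p : @site 5 (@Ordinal 10 4 p) = 2 by apply/val_inj.
have s5 p : @site 5 (@Ordinal 10 5 p) = 2 by apply/val_inj.
have s6 p : @site 5 (@Ordinal 10 6 p) = - 2 by apply/val_inj.
have s7 p : @site 5 (@Ordinal 10 7 p) = - 2 by apply/val_inj.
have s8 p : @site 5 (@Ordinal 10 8 p) = - 1 by apply/val_inj.
have s9 p : @site 5 (@Ordinal 10 9 p) = - 1 by apply/val_inj.
move: c0 c1 c2 c3 c4; rewrite !s0 !s1 !s2 !s3 !s4 !s5 !s6 !s7 !s8 !s9.
rewrite /dot !xor_I5 !ffunE /majorana_z /= ?andbT ?andbF ?addbF ?addFb.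
move=> c0 c1 c2 c3 c4.
have addE p q : p (+) q = false -> p = q by case: p; case: q.
have z3E : z (t, kappa t (- 2)) =
    z (t, kappa t 0) (+) (y (t, kappa t 1) (+) y (t, kappa t 2)).
  by apply: addE; rewrite addbA [_ (+) z _]addbC.
have z4E : z (t, kappa t (- 1)) =
    z (t, kappa t 1) (+) (y (t, kappa t 2) (+) y (t, kappa t (- 2))).
  by apply: addE; rewrite addbA [_ (+) z _]addbC.
have fE := addE _ _ c0; move: c2 c4; rewrite -fE z3E z4E.
move: i; apply: (forall_I5 (j := 0)); rewrite ?I5E ?add0r ?sub0r ?z3E ?z4E.
all: move: (y (t, kappa t 0)) (y (t, kappa t 1)) (y (t, kappa t 2)).
all: move: (y (t, kappa t (- 2))) (y (t, kappa t (- 1))) (z (t, kappa t 0)).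
all: move: (z (t, kappa t 1)) (z (t, kappa t 2)).
all: by do 8 case.
Qed.

Variables (cross : side -> side) (pos : pred side) (n : nat) (bd : n.-tuple side).
Hypothesis crossK : involutive cross.
Hypothesis cross_pos : forall d, cross d != d -> pos (cross d) = ~~ pos d.
Hypothesis bd_uniq : uniq bd.
Hypothesis cross_bd : forall i, cross (tnth bd i) = tnth bd i.

(* Configurations that agree on both copies of each shared side, and the
   characters whose sum is proportional to their indicator function. *)
Definition consistent s := [forall d, s (cross d) == s d].

Definition dual z := consistent z && [forall d, (cross d == d) ==> ~~ z d].

Definition bd_bits s : bits n := [ffun i => s (tnth bd i)].

Definition network b (x : bits n) : C :=
  \sum_(s | consistent s && (bd_bits s == x)) amplitude b s.

Lemma consistentP s : reflect (forall d, s (cross d) = s d) (consistent s).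
Proof. by apply: (iffP forallP) => h d; apply/eqP/h. Qed.

Lemma addcK s : involutive (addc s).
Proof. by move=> y; apply/ffunP=> d; rewrite !ffunE addKb. Qed.

Lemma consistent_addc s y : consistent s -> consistent (addc s y) = consistent y.
Proof.
move=> /consistentP cs; apply/consistentP/consistentP=> h d; have := h d; rewrite !ffunE cs //.
  by move/addbI.
by move=> ->.
Qed.

(** Orthogonality of characters. For consistent s the two copies of each side cancel in [dot z s];
    otherwise, toggling z on both copies of a side where s disagrees reverses the sign. *)
Lemma dual_sum s : \sum_(z | dual z) (-1) ^+ dot z s =
  if consistent s then #|[pred z | dual z]|%:R else 0 :> C.
Proof.
case: (boolP (consistent s)) => [/consistentP cs|].
  rewrite -sum1_card natr_sum; apply: eq_bigr => z /andP[/consistentP cz /forallP z0].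
  rewrite (_ : dot z s = false) //; apply: (xor_involution crossK cross_pos).
    by move=> d /=; rewrite cz cs.
  by move=> d /eqP dd; have := z0 d; rewrite dd /= => /negbTE->.
rewrite negb_forall => /existsP[d0 sd0].
have d0' : cross d0 != d0 by apply: contra sd0 => /eqP->.
pose tg z : config := [ffun d => (d == d0) (+) ((d == cross d0) (+) z d)].
have tgK : involutive tg.
  move=> z; apply/ffunP=> d; rewrite !ffunE.
  by case: (d == _); case: (d == _); case: (z d).
have crossE d d' : (cross d == d') = (d == cross d') by apply: can2_eq.
have tg_dual z : dual z -> dual (tg z).
  case/andP=> /consistentP cz /forallP z0; apply/andP; split.
    by apply/consistentP=> d; rewrite !ffunE cz !crossE crossK addbCA.
  apply/forallP=> d; apply/implyP=> /eqP dd; rewrite !ffunE.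
  have := z0 d; rewrite dd eqxx /= => /negbTE->; rewrite addbF.
  have -> : (d == cross d0) = (d == d0) by rewrite -crossE dd.
  by rewrite addbb.
have : \sum_(z | dual z) (-1) ^+ dot z s = - \sum_(z | dual z) (-1) ^+ dot z s :> C.
  rewrite [LHS](reindex_inj (can_inj tgK)) -sumrN; apply: eq_big => [z|z _].
    by apply/idP/idP=> [/tg_dual|/tg_dual//]; rewrite tgK.
  have -> : dot (tg z) s = ~~ dot z s; last by rewrite signrN.
  rewrite /dot (eq_bigr (fun d => ((d == d0) && s d (+) (d == cross d0) && s d) (+) z d && s d)).
    rewrite !big_split /=.
    have one d1 : \big[addb/false]_d ((d == d1) && s d) = s d1.
      by rewrite (bigD1 d1) //= eqxx big1 ?addbF // => d /negbTE->.
    by rewrite !one; move: sd0; case: (s d0); case: (s (cross d0)).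
  by move=> d _; rewrite ffunE !andb_addl addbA.
by move=> /eqP; rewrite -addr_eq0 -mulr2n mulrn_eq0 => /eqP.
Qed.

(** Summing over characters instead of consistent configurations writes the overlap, up to a
    positive factor, as a sum over y and z that extend [xb] and [zb]; some term of it is nonzero. *)
Lemma network_overlap b b' (zb : 'I_n -> bool) (xb : bits n) :
  \sum_x (network b x)^* * ((-1) ^+ dot zb x * network b' [ffun i => xb i (+) x i]) != 0 ->
  exists y, exists z, [/\ forall d, y (cross d) = y d, forall i, y (tnth bd i) = xb i,
    forall d, z (cross d) = z d, forall i, z (tnth bd i) = zb i
    & \sum_s weight b b' z y s != 0].
Proof.
pose zext d := [exists i, zb i && (d == tnth bd i)].
have zextE i : zext (tnth bd i) = zb i.
  apply/existsP/idP=> [[j /andP[zj /eqP/(tuple_uniqP _ bd_uniq) ->]] //|zi].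
  by exists i; rewrite zi eqxx.
have zext_bd d : zext d -> cross d = d.
  by case/existsP=> i /andP[_ /eqP->].
pose add z : config := [ffun d => zext d (+) z d].
have [[y z] /= /andP[/and3P[/consistentP cy /eqP yb dz] ne] none|none] :=
  pickP (fun yz : config * config => [&& consistent yz.1, bd_bits yz.1 == xb & dual yz.2]
    && (\sum_s weight b b' (add yz.2) yz.1 s != 0)).
  have /andP[/consistentP cz /forallP z0] := dz.
  exists y, (add z); split=> // [i|d|i].
  - by have /ffunP/(_ i) := yb; rewrite !ffunE.
  - rewrite !ffunE cz; congr (_ (+) _).
    apply/idP/idP=> h; have := zext_bd _ h; last by move=> e; rewrite e.
    by rewrite crossK => e; rewrite e.
  - rewrite ffunE zextE; have := z0 (tnth bd i); rewrite cross_bd eqxx /= => /negbTE->.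
    by rewrite addbF.
case/negP; apply/eqP.
pose g y s : C := (-1) ^+ dot zb (bd_bits s) * ((amplitude b s)^* * amplitude b' (addc s y)).
(* [y] is the difference of the configurations in the bra and the ket. *)
transitivity (\sum_(s | consistent s) \sum_(y | consistent y && (bd_bits y == xb)) g y s).
  rewrite [RHS](partition_big bd_bits xpredT) //=; apply: eq_bigr => x _.
  rewrite /network rmorph_sum big_distrl /=; apply: eq_bigr => s /andP[cs /eqP sx].
  rewrite mulrCA big_distrr big_distrr /= -sx.
  rewrite (reindex_inj (can_inj (addcK s))) /=; apply: eq_big => [y|y _]; last by rewrite /g; ring.
  rewrite consistent_addc //; congr (_ && _).
  apply/eqP/eqP=> /ffunP h; apply/ffunP=> i; have := h i; rewrite !ffunE.
    by rewrite addbC => /addIb.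
  by move=> ->; rewrite addbC.
rewrite exchange_big big1 //= => y /andP[cy yb].
have dual_gt0 : (0 < #|[pred z | dual z]|)%N.
  apply/card_gt0P; exists [ffun=> false]; rewrite inE; apply/andP; split.
    by apply/consistentP=> d; rewrite !ffunE.
  by apply/forallP=> d; rewrite ffunE implybT.
apply: (mulfI (x := #|[pred z | dual z]|%:R)); first by rewrite pnatr_eq0 -lt0n.
rewrite mulr0 big_distrr /= big_mkcond /=.
transitivity (\sum_(s : config) (\sum_(z | dual z) (-1) ^+ dot z s) * g y s : C).
  by apply: eq_bigr => s _; rewrite dual_sum; case: ifP => _; rewrite ?mul0r.
under eq_bigr do rewrite big_distrl.
rewrite exchange_big big1 //= => z dz.
have := none (y, z); rewrite /= cy yb dz /= => /negbFE/eqP w0; rewrite -[RHS]w0.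
apply: eq_bigr => s _; rewrite /g /weight mulrA signM; congr ((-1) ^+ _ * _).
have -> : dot (add z) s = dot zext s (+) dot z s.
  by rewrite -dotDl; apply: eq_dot => // d; rewrite ffunE.
rewrite addbC; congr (_ (+) _).
transitivity (\big[addb/false]_(d <- bd) (zext d && s d)).
  by rewrite big_tuple; apply: eq_bigr => i _; rewrite zextE ffunE.
rewrite [LHS](big_uniq _ bd_uniq) [LHS]big_mkcond; apply: eq_bigr => d _.
case: ifP => // /negP dbd; case: (boolP (zext d)) => // /existsP[i /andP[_ /eqP di]].
by case: dbd; rewrite di mem_tnth.
Qed.
End Network.
End Overlap.

(** * The patch in the hyperbolic plane *)

(** Tiles that are adjacent around the vertex differ in orientation, and opposite ones by the last
    hypothesis. *)
Lemma generic_colored (U : eqType) (s : 'I_5 -> U -> U) (G o : pred U) :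
  (forall k, involutive (s k)) ->
  (forall k u, s k (s (k + 1) u) = s (k + 1) (s k u)) ->
  (forall k u, G u -> G (s k u)) -> (forall k u, G u -> o (s k u) = ~~ o u) ->
  (forall k u, G u -> u != s k (s (k + 1) u)) ->
  forall u, G u -> generic s u.
Proof.
move=> sK sC Gs os s2 u Gu k.
have neq v w : o v = ~~ o w -> v == w = false.
  by move=> vw; apply/eqP=> e; move: vw; rewrite e; case: (o w).
have Gk := Gs k u Gu; have Gk1 := Gs (k + 1) u Gu.
have n1 := s2 k u Gu; rewrite /= !inE (negbTE n1).
have -> : s k u == s (k + 1) u = false.
  by apply: contraNF n1 => /eqP <-; rewrite sK.
rewrite (neq u (s k u)) ?(neq u (s (k + 1) u)) ?(neq (s (k + 1) u)) ?os ?negbK //.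
by rewrite sC (neq (s k u)) ?os ?negbK.
Qed.

Lemma mulmx_swap (R : realType) (u A B : 'M[R]_3) :
  A *m B = B *m A -> u *m B *m A = u *m A *m B.
Proof. by move=> AB; rewrite -!mulmxA AB. Qed.

Section TilingAction.
Variable R : realType.
Notation M := 'M[R]_3.

Definition across (k : 'I_5) (u : M) : M := u *m reflection R k.
Definition positive (u : M) : bool := 0 < \det u.
Definition in_tiling (u : M) : bool := `[< tiling_group u >].

Lemma acrossK k : involutive (across k).
Proof. by move=> u; rewrite /across -mulmxA reflectionK mulmx1. Qed.

Lemma acrossC k u : across k (across (k + 1) u) = across (k + 1) (across k u).
Proof. exact: mulmx_swap (reflectionC R k). Qed.

Lemma in_tilingP u : reflect (tiling_group u) (in_tiling u).
Proof. exact: asboolP. Qed.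

Lemma across_in k u : in_tiling u -> in_tiling (across k u).
Proof.
move=> /in_tilingP[w ->]; apply/in_tilingP; exists (rcons w k).
by rewrite /across big_rcons /= -mulmxE.
Qed.

Lemma det_in_tiling u : in_tiling u -> \det u != 0.
Proof.
move=> /in_tilingP[w ->]; elim: w => [|k w IH]; first by rewrite big_nil det1 oner_neq0.
by rewrite big_cons -mulmxE det_mulmx det_reflection mulN1r oppr_eq0.
Qed.

Lemma positive_across k u : in_tiling u -> positive (across k u) = ~~ positive u.
Proof.
move=> /det_in_tiling u0; rewrite /positive /across det_mulmx det_reflection mulrN1.
by rewrite oppr_gt0 -leNgt le_eqVlt (negbTE u0).
Qed.

Lemma across2_neq k u : in_tiling u -> u != across k (across (k + 1) u).
Proof.
move=> /in_tilingP[w ->]; apply/eqP=> e.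
have inv := prod_rev (@reflectionK R) (rev w); rewrite revK -mulmxE in inv.
have := congr1 (mulmx (\prod_(i <- rev w) reflection R i)) e.
rewrite /across !mulmxA inv !mul1mx mulmxE => e1.
have : \prod_(i <- [:: k + 1; k]) reflection R i = 1 by rewrite big_cons big_seq1.
by move/reduced_prod_neq1; rewrite /= I5_neq !andbF => /(_ isT).
Qed.

Lemma generic_in_tiling u : in_tiling u -> generic across u.
Proof. exact: generic_colored acrossK acrossC across_in positive_across across2_neq u. Qed.

(** [h u] is the path sum from the base tile along any word for [u]; by [path_sum_end] the word does
    not matter. *)
Lemma potential_exists (phi : M -> 'I_5 -> bool) :
  (forall u k, phi (across k u) k = phi u k) ->
  (forall u k, phi u k (+) phi (across k u) (k + 1)
     = phi u (k + 1) (+) phi (across (k + 1) u) k) ->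
  exists h : M -> bool, forall u k, in_tiling u -> h (across k u) = h u (+) phi u k.
Proof.
move=> phi_s phi_v; pose S := path_sum (@reflection R) phi 1.
pose h (u : M) := if pselect (tiling_group u) is left tu then S (projT1 (cid tu)) else false.
have hE w : h (\prod_(k <- w) reflection R k) = S w.
  rewrite /h; case: pselect => [tu|]; last by case; exists w.
  case: (cid tu) => w' /= e.
  exact: (path_sum_end (@reflectionK R) (@reflectionC R) (@reduced_prod_neq1 R) phi_s phi_v).
exists h => u k /in_tilingP[w ->].
have -> : across k (\prod_(k <- w) reflection R k) = \prod_(k <- rcons w k) reflection R k.
  by rewrite big_rcons /= -mulmxE.
by rewrite !hE -cats1 /S path_sum_cat /= addbF mul1r.
Qed.
End TilingAction.

(** * Orthogonality of boundary states under Majorana pairs *)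

Section Orthogonality.
Variables (R : realType) (N n : nat) (P : 'I_N -> 'M[R]_3).
Hypothesis hP : is_patch P.
Variable e : n.-tuple ('I_N * 'I_5).
Hypothesis he : clockwise_boundary P e.
Variables (code : bool -> qstate R 5) (start : 'I_N -> 'I_5).
Hypothesis hcode : forall a, code_state a (code a).

Notation C := R[i].
Notation s := (@across R).
Notation pos := (@positive R).
Notation side := ('I_N * 'I_5)%type.

Let P_inj : injective P. Proof. by case: hP. Qed.
Let GP t : in_tiling (P t). Proof. by case: hP => _ _ tP _ _; apply/in_tilingP. Qed.

Notation cross := (@cross _ s N P).
Notation bdry := (@bdry _ s N P).

Lemma shares_nbr t t' k : shares_side P t t' k = (nbr s P (t, k) == Some t').
Proof. by rewrite (nbr_Some s P_inj). Qed.

Lemma boundary_bdry d : boundary_edge P d = bdry d.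
Proof.
case: d => t k; rewrite /boundary_edge /bdry; apply/forallP/eqP => [none|h t'].
  by case nb: (nbr _ _ _) => [t'|] //; have := none t'; rewrite shares_nbr nb eqxx.
by rewrite shares_nbr h.
Qed.

Lemma next_follows d d' : next_edge P d d' -> follows s pos P d d'.
Proof.
elim=> [t k b|t k t' {}d' sh _ IH].
  by apply: (follows_stop (d := (t, k))); rewrite -boundary_bdry.
have nb : nbr s P (cw pos P (t, k)) = Some t' by apply/eqP; rewrite -shares_nbr.
apply: follows_cross; first by rewrite /bdry nb.
by rewrite /vnext /cross nb.
Qed.

Lemma mem_boundary d : (d \in e) = bdry d.
Proof. by case: he => _ -> _; apply: boundary_bdry. Qed.

Lemma boundary_follows i : follows s pos P (tnth e i) (tnth e (ordS i)).
Proof. by case: he => _ _ h; apply: next_follows. Qed.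

Lemma connected_patch : connected_tiles s (tiles P).
Proof.
move=> Q [u0 /mem_tiles[t0 ->] Q0] Qs u /mem_tiles[t ->].
have [_ _ _ conP _] := hP; have /connectP[p pth ->] := conP t0 t.
elim: p t0 Q0 pth => //= t1 p IH t0 Q0 /andP[/existsP[k /eqP sh]]; apply: IH.
by rewrite sh; apply: Qs => //; rewrite ?P_in_tiles // /across -sh P_in_tiles.
Qed.

Let kappa t := clockwise (P t) (start t).

Lemma kappa_inj t : injective (kappa t).
Proof. by move=> i j; rewrite /kappa /clockwise; case: ifP => _ /addrI // /oppr_inj. Qed.

Lemma contractionE b : contraction P code start e b = [ffun x => network kappa code cross e b x].
Proof.
apply/ffunP=> x; rewrite !ffunE; apply: eq_bigl => c; congr (_ && _).
  apply/forallP/(consistentP (@cross) c) => [h [t k]|h t].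
    rewrite /cross; case nb: (nbr _ _ _) => [t'|] //=.
    have /forallP/(_ k)/implyP := forallP (h t) t'; rewrite shares_nbr nb eqxx.
    by move=> /(_ isT)/eqP.
  apply/forallP=> t'; apply/forallP=> k; apply/implyP; rewrite shares_nbr => /eqP nb.
  by have := h (t, k); rewrite /cross nb /= => ->.
apply/forallP/eqP => [h|/ffunP h i]; last by have := h i; rewrite ffunE => ->.
by apply/ffunP=> i; rewrite ffunE; apply/eqP.
Qed.

(** A nonzero overlap would yield exponents y and z that solve the tile equations with f = b + b',
    and [patch_parity_eq0] would give b = b'. *)
Lemma network_orth b b' (j k : 'I_n.*2) : b != b' ->
  \sum_x (network kappa code cross e b x : C)^* *
    ((-1) ^+ dot (fun i => majorana_z j i (+) majorana_z k i) x *
     network kappa code cross e b' (flip (site k) (flip (site j) x))) = 0.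
Proof.
move=> bb'; apply/eqP; apply: contraNT bb' => ne0.
pose xb : bits n := [ffun i => (i == site k) (+) (i == site j)].
have flipE (x : bits n) : flip (site k) (flip (site j) x) = [ffun i => xb i (+) x i].
  by apply/ffunP=> i; rewrite !ffunE addbA.
have cross_pos d : cross d != d -> pos (P (cross d).1) = ~~ pos (P d.1).
  move=> dd; apply: (o_cross (@positive_across R) P_inj GP).
  by apply: contra dd => /cross_bdry ->.
have cross_bd i : cross (tnth e i) = tnth e i.
  by apply: cross_bdry; rewrite -mem_boundary mem_tnth.
have ue : uniq e by case: he.
have [y [z [cy yb cz zb ne]]] : exists y z : {ffun side -> bool},
  [/\ forall d, y (cross d) = y d, forall i, y (tnth e i) = xb i,
    forall d, z (cross d) = z d,
    forall i, z (tnth e i) = majorana_z j i (+) majorana_z k i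
    & \sum_s weight kappa code b b' z y s != 0].
  apply: (@network_overlap _ _ kappa code cross (fun d => pos (P d.1))) => //.
    exact: (crossK (@acrossK R) P_inj).
  by rewrite (eq_bigr _ (fun x _ => congr1 (fun w => _ * (_ * network _ _ _ _ _ w)) (flipE x))) in ne0.
have eqs t i : y (t, i - 1) (+) y (t, i) (+) y (t, i + 1)
     (+) z (t, i - 1) (+) z (t, i + 1) = b t (+) b' t.
  have h m := tile_equations kappa_inj hcode t m ne.
  (* The equations are symmetric under reversal of the order of the sides, so the orientation of the
     tile does not matter. *)
  move: h; rewrite /kappa /clockwise; case: (0 < \det (P t)) => h.
    have st m : start t + (i - start t + m) = i + m by rewrite addrA addrCA subrr addr0.
    have st0 : start t + (i - start t) = i by rewrite addrCA subrr addr0.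
    by have := h (i - start t); rewrite !st st0.
  have st m : start t - (start t - i + m) = i - m by rewrite opprD opprB addrA addrCA subrr addr0.
  have st0 : start t - (start t - i) = i by rewrite opprB addrCA subrr addr0.
  have := h (start t - i); rewrite !st st0 opprK.
  by case: (y (t, i)); case: (y (t, i + 1)); case: (y (t, i - 1)); case: (z (t, i + 1));
    case: (z (t, i - 1)).
suff ff t : b t (+) b' t = false.
  by apply/eqP/ffunP=> t; have := ff t; case: (b t); case: (b' t).
have xE i : y (tnth e i) = (i == site k) (+) (i == site j) by rewrite yb ffunE.
(* Strictly between the two sites exactly one of the Jordan-Wigner strings acts; outside, both or
   none do. *)
have zE i (a c : 'I_n) : (a <= c)%N -> (a == site j) && (c == site k) || (a == site k) && (c == site j) ->
    i != a -> i != c -> z (tnth e i) = (a < i < c)%N.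
  move=> ac /orP acE ia ic; rewrite zb /majorana_z.
  have -> : (i < site j)%N || (i == site j) && odd j = (i < site j)%N.
    by case: acE ia ic => /andP[/eqP-> /eqP->] /negbTE e1 /negbTE e2; rewrite ?e1 ?e2 /= orbF.
  have -> : (i < site k)%N || (i == site k) && odd k = (i < site k)%N.
    by case: acE ia ic => /andP[/eqP-> /eqP->] /negbTE e1 /negbTE e2; rewrite ?e1 ?e2 /= orbF.
  have [i' i'E] : exists i' : nat, i' = i by exists i.
  have [a' a'E] : exists a' : nat, a' = a by exists a.
  have [c' c'E] : exists c' : nat, c' = c by exists c.
  by case: acE ac ia ic => /andP[/eqP <- /eqP <-]; rewrite -!val_eqE /= -i'E -a'E -c'E; clear; lia.
have key := patch_parity_eq0 (@acrossK R) (@acrossC R) (@across_in R) (@positive_across R)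
  (@generic_in_tiling R) (@potential_exists R) P_inj GP mem_boundary boundary_follows
  ue connected_patch cy cz eqs.
case: (leqP (site j) (site k)) => jk.
  apply: (key (site j) (site k)) => // [i|i ij ik]; first by rewrite xE addbC.
  by apply: zE; rewrite // !eqxx.
apply: (key (site k) (site j)) => // [|i ij ik]; first exact: ltnW.
by apply: zE; rewrite // ?(ltnW jk) // !eqxx orbT.
Qed.
End Orthogonality.

(** * Correlators of superpositions *)

Section Covariance.
Variables (R : realType) (n : nat).
Notation C := R[i].
Implicit Types psi phi : qstate R n.

Definition pair_corr (j k : 'I_n.*2) psi phi : C := inner psi (majorana j (majorana k phi)).

Lemma pair_corrE j k : exists c : C, forall psi phi, pair_corr j k psi phi =
  c * \sum_x (psi x : C)^* *
    ((-1) ^+ dot (fun i => majorana_z j i (+) majorana_z k i) x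
      * phi (flip (site k) (flip (site j) x))).
Proof.
have [c cE] := majorana2E R j k; exists c => psi phi.
rewrite /pair_corr /inner big_distrr /=; apply: eq_bigr => x _.
by rewrite cE; ring.
Qed.

Lemma pair_corr_sum (I : finType) (j k : 'I_n.*2) (c : I -> C) (K : I -> qstate R n) :
  pair_corr j k (\sum_b c b *: K b) (\sum_b c b *: K b) =
  \sum_b \sum_b' (c b)^* * c b' * pair_corr j k (K b) (K b').
Proof.
have [d dE] := pair_corrE j k; rewrite dE.
have sumE x : (\sum_b c b *: K b) x = \sum_b c b * K b x :> C.
  by rewrite sum_ffunE; apply: eq_bigr => b _; rewrite ffunE.
under [RHS]eq_bigr do under eq_bigr do rewrite dE mulrCA.
under [RHS]eq_bigr do rewrite -big_distrr /=.
rewrite -big_distrr /=; congr (_ * _).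
under [RHS]eq_bigr do under eq_bigr do rewrite big_distrr /=.
under [RHS]eq_bigr do rewrite exchange_big /=.
rewrite [RHS]exchange_big /=; apply: eq_bigr => x _.
rewrite !sumE rmorph_sum big_distrl /=; apply: eq_bigr => b _.
rewrite big_distrr big_distrr /=; apply: eq_bigr => b' _.
by rewrite rmorphM /=; ring.
Qed.

Lemma covarianceE psi j k :
  covariance psi j k = 'i / 2 * (pair_corr j k psi psi - pair_corr k j psi psi) :> C.
Proof.
rewrite /covariance mxE /pair_corr /inner -sumrB; congr (_ * _).
by apply: eq_bigr => x _; rewrite !ffunE -[X in _ * X]/(_ - _ : C) mulrBr.
Qed.
End Covariance.

Theorem theorem3 (R : realType) (N n : nat) (P : 'I_N -> 'M[R]_3)
    (hP : is_patch P)
    (e : n.-tuple ('I_N * 'I_5)) (he : clockwise_boundary P e)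
    (code : bool -> qstate R 5) (hcode : forall a, code_state a (code a))
    (start : 'I_N -> 'I_5)
    (c : {ffun 'I_N -> bool} -> R[i]) (hc : \sum_b `|c b| ^+ 2 = 1) :
  let ket := boundary_state P code start e in
  let omega := \sum_b c b *: ket b in
  exists w : {ffun 'I_N -> bool} -> R,
    [/\ forall b, 0 <= w b,
        \sum_b w b = 1
      & covariance omega = \sum_b (w b)%:C%C *: covariance (ket b)].
Proof.
move=> ket omega.
have ket_orth b b' j k : b != b' -> pair_corr j k (ket b) (ket b') = 0.
  move=> bb'; have [d dE] := pair_corrE R j k; rewrite dE.
  rewrite /ket /boundary_state /normalize !(contractionE hP).
  set u := _^-1; set v := _^-1.
  transitivity (d * (u^* * v * 0) : R[i]); last by rewrite !mulr0.
  rewrite -[in RHS](network_orth hP he start hcode j k bb').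
  congr (_ * _); rewrite big_distrr /=; apply: eq_bigr => x _.
  by rewrite !ffunE -![_ *: _]/(_ * _ : R[i]) rmorphM /=; ring.
(* The off-diagonal terms vanish, which leaves the weights |c_b|^2. *)
have pairE j k : pair_corr j k omega omega =
    \sum_b `|c b| ^+ 2 * pair_corr j k (ket b) (ket b).
  rewrite pair_corr_sum; apply: eq_bigr => b _.
  rewrite (bigD1 b) //= big1 => [|b' b'b]; last by rewrite ket_orth ?mulr0 // eq_sym.
  by rewrite addr0 normCK [c b * _]mulrC.
pose w b : R := complex.Re (c b) ^+ 2 + complex.Im (c b) ^+ 2.
have wE b : (w b)%:C%C = `|c b| ^+ 2 by exact: add_Re2_Im2.
exists w; split=> [b||].
- by rewrite addr_ge0 ?sqr_ge0.
- apply: (fmorph_inj (real_complex R)); rewrite rmorph_sum rmorph1 -hc.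
  by apply: eq_bigr => b _; exact: wE.
apply/matrixP=> j k; rewrite covarianceE summxE !pairE -sumrB big_distrr /=.
apply: eq_bigr => b _; rewrite mxE covarianceE wE; ring.
Qed.
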